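(* Let $(X,d)$ be a complete metric space that supports a doubling Borel measure $\mu$ which is non-trivial and finite on balls. If $X$ supports a local weak $p$-Poincaré inequality for some $1\leq p<\infty$, then $N^{1,\infty}(X)=D^{\infty}(X)$ with equivalent norms.
   Context: $(X,d,\mu)$ is a metric measure space with $\mu$ Borel regular: $\mu$ is an outer measure for which Borel sets are measurable and every $A\subset X$ is contained in a Borel set $B$ with $\mu(A)=\mu(B)$. $\|\cdot\|_{L^\infty}$ is the $\mu$-essential supremum norm and $\|\cdot\|_\infty$ the supremum norm. For $f:X\to\mathbb{R}$, $\mathrm{Lip} f(x)=\limsup_{y\to x,\,y\neq x}\frac{|f(x)-f(y)|}{d(x,y)}$ at non-isolated $x$, and $\mathrm{Lip} f(x)=0$ at isolated $x$. $D^\infty(X)$ is the space of bounded $f:X\to\mathbb{R}$ with $\|\mathrm{Lip} f\|_\infty=\sup_x\mathrm{Lip} f(x)<\infty$, with norm $\|f\|_{D^\infty}=\max\{\|f\|_\infty,\|\mathrm{Lip} f\|_\infty\}$. Curves: for a continuous curve $\gamma:[a,b]\to X$, $\ell(\gamma)=\sup\sum_i d(\gamma(t_i),\gamma(t_{i+1}))$ over partitions of $[a,b]$; $\gamma$ is rectifiable if $\ell(\gamma)<\infty$. For Borel $g\ge 0$, $\int_\gamma g$ is the line integral with respect to arc length. $\Upsilon$ is the family of nonconstant rectifiable curves in $X$. Upper gradients: a Borel function $g\ge0$ is an upper gradient of an extended real-valued function $f$ on $X$ if $|f(\gamma(a))-f(\gamma(b))|\le\int_\gamma g$ for every rectifiable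 curve $\gamma:[a,b]\to X$ (the left side being $+\infty$ if $f(\gamma(a))$ or $f(\gamma(b))$ is infinite); an upper gradient in a subset is defined in the same way using curves in that subset. For $\Gamma\subset\Upsilon$, $\mathrm{Mod}_\infty(\Gamma)=\inf\|\rho\|_{L^\infty}$ over all Borel $\rho:X\to[0,\infty]$ with $\int_\gamma\rho\ge1$ for all $\gamma\in\Gamma$. A property holds for $\infty$-a.e. curve if it holds for all $\gamma\in\Upsilon\setminus\Gamma$ for some $\Gamma$ with $\mathrm{Mod}_\infty(\Gamma)=0$. A Borel $g\ge0$ is an $\infty$-weak upper gradient of $f$ if $|f(\gamma(a))-f(\gamma(b))|\le\int_\gamma g$ holds for $\infty$-a.e. curve $\gamma:[a,b]\to X$ in $\Upsilon$ (with the same convention that the left side is $+\infty$ if $f(\gamma(a))$ or $f(\gamma(b))$ is infinite). $\widetilde N^{1,\infty}(X)$ is the class of Borel functions $f\in L^\infty(X)$ having an $\infty$-weak upper gradient in $L^\infty$, with $\|f\|_{\widetilde N^{1,\infty}}=\|f\|_{L^\infty}+\inf_g\|g\|_{L^\infty}$ over all $\infty$-weak upper gradients $g$ of $f$; $N^{1,\infty}(X)$ is the quotient by $u\sim v\iff\|u-v\|_{\widetilde N^{1,\infty}}=0$, with the induced norm. $D^\infty(X)$ is regarded inside $N^{1,\infty}(X)$ via $f\mapsto[f]$. Doubling: there is $C_\mu>0$ with $0<\mu(B(x,2r))\le C_\mu\,\mu(B(x,r))<\infty$ for all $x\in X$, $r>0$ ($B(x,r)$ the open ball). Local weak $p$-Poincaré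 inequality with constant $C_p$: for every $x\in X$ there exist a neighborhood $U_x$ of $x$ and $\lambda\ge1$ such that whenever $B=B(y,r)$ is a ball in $X$ with $\lambda B=B(y,\lambda r)\subset U_x$, and $u$ is an integrable function on $\lambda B$ with $g$ as its upper gradient in $\lambda B$, then $\frac{1}{\mu(B)}\int_{B}|u-u_{B}|\,d\mu\le C_p\,r\Big(\frac{1}{\mu(\lambda B)}\int_{\lambda B}g^p\,d\mu\Big)^{1/p}$, where $u_{B}=\frac1{\mu(B)}\int_B u\,d\mu$. *)

(* Defs.v *)
From HB Require Import structures.
From mathcomp Require Import all_boot all_order all_algebra.
From mathcomp Require Import all_classical all_reals all_analysis measurable_realfun.

Set Implicit Arguments.
Unset Strict Implicit.
Unset Printing Implicit Defensive.

Import Order.TTheory GRing.Theory Num.Theory.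
Import numFieldNormedType.Exports.

Local Open Scope classical_set_scope.
Local Open Scope ring_scope.

(* Measurable types are pointed in the library, hence the base point. *)
#[short(type="pMetricType")]
HB.structure Definition PMetric (K : numDomainType) :=
  { T of Metric K T & Pointed T }.

#[short(type="completeMetricType")]
HB.structure Definition CompleteMetric (K : numDomainType) :=
  { T of PMetric K T & Complete T }.

Section MetricMeasureSpace.
Context {R : realType} {X : pMetricType R}.
Local Open Scope ereal_scope.

Definition borelType : measurableType (@open X).-sigma :=
  g_sigma_algebraType (@open X).

Definition borel_set (B : set X) := measurable (B : set borelType).

(* Functions on a subset A are total functions of which only the values on A
   matter.  The library's measurable_fun is vacuous if A is not itself Borel;
   below, A is always an open ball or the whole space. *)
Definition borel_fun_on (A : set X) (f : X -> \bar R) :=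
  measurable_fun (A : set borelType) (f : borelType -> \bar R).

Definition borel_regular (mu : {outer_measure set X -> \bar R}) :=
  borel_set `<=` mu.-caratheodory /\
  forall A : set X, exists B, [/\ borel_set B, A `<=` B & mu A = mu B].

Definition doubling (mu : {outer_measure set X -> \bar R}) :=
  exists2 C : R, (0 < C)%R & forall (x : X) (r : R), (0 < r)%R ->
    [/\ 0 < mu (ball x (2 * r)),
        mu (ball x (2 * r)) <= C%:E * mu (ball x r) &
        C%:E * mu (ball x r) < +oo].

(* Integrals and essential suprema are taken with respect to the restriction
   of mu to its Caratheodory-measurable sets. *)
Definition cara (mu : {outer_measure set X -> \bar R}) :
  {measure set (caratheodory_type mu) -> \bar R} := mu.

Definition Linfty_norm (mu : {outer_measure set X -> \bar R})
    (f : X -> \bar R) : \bar R :=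
  Lnorm (cara mu) +oo (f : caratheodory_type mu -> \bar R).

Definition curve_length (gamma : R -> X) (a b : R) : \bar R :=
  ereal_sup [set (let F := gamma \o nth b (a :: s) in
                  \sum_(0 <= n < size s) mdist (F n) (F n.+1))%R%:E
            | s in itv_partition a b].

Record curve := Curve {
  cstart : R;
  cend : R;
  cmap :> R -> X;
  cstart_le_cend : (cstart <= cend)%R;
  cmap_continuous : {within `[cstart, cend], continuous cmap}
}.

Definition clength (gamma : curve) : \bar R :=
  curve_length gamma (cstart gamma) (cend gamma).

Definition rectifiable (gamma : curve) := clength gamma < +oo.

Definition curve_in (A : set X) (gamma : curve) :=
  gamma @` `[cstart gamma, cend gamma] `<=` A.

Definition nonconstant (gamma : curve) :=
  exists s t, [/\ s \in `[cstart gamma, cend gamma],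
                  t \in `[cstart gamma, cend gamma] & gamma s != gamma t].

Definition Upsilon : set curve :=
  [set gamma | rectifiable gamma /\ nonconstant gamma].

(* The arc-length parametrization [0, l(gamma)] -> X: the point of gamma
   reached at the last time at which the length travelled is s. *)
Definition arc_param (gamma : curve) (s : R) : X :=
  gamma (sup [set t | t \in `[cstart gamma, cend gamma] /\
                      curve_length gamma (cstart gamma) t = s%:E]).

Definition line_integral (gamma : curve) (g : X -> \bar R) : \bar R :=
  \int[lebesgue_measure]_(s in `[0%R, fine (clength gamma)])
    g (arc_param gamma s).

(* In \bar R a sum with an infinite term is infinite (oo - oo = -oo), so the
   left side is +oo as soon as f is infinite at one of the end points. *)
Definition ug_inequality (f g : X -> \bar R) (gamma : curve) :=
  `|f (gamma (cstart gamma)) - f (gamma (cend gamma))|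
    <= line_integral gamma g.

Definition upper_gradient_in (A : set X) (f g : X -> \bar R) :=
  [/\ borel_fun_on A g,
      forall x, A x -> 0 <= g x &
      forall gamma, rectifiable gamma -> curve_in A gamma ->
        ug_inequality f g gamma].

Definition Mod_infty (mu : {outer_measure set X -> \bar R})
    (Gamma : set curve) : \bar R :=
  ereal_inf [set Linfty_norm mu rho | rho in
    [set rho : X -> \bar R | [/\ borel_fun_on setT rho, forall x, 0 <= rho x &
       forall gamma, Gamma gamma -> 1 <= line_integral gamma rho]]].

Definition infty_ae_curve (mu : {outer_measure set X -> \bar R})
    (P : curve -> Prop) :=
  exists Gamma : set curve, [/\ Gamma `<=` Upsilon, Mod_infty mu Gamma = 0 &
    forall gamma, (Upsilon `\` Gamma) gamma -> P gamma].

Definition weak_upper_gradient (mu : {outer_measure set X -> \bar R})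
    (f g : X -> \bar R) :=
  [/\ borel_fun_on setT g, forall x, 0 <= g x &
      infty_ae_curve mu (ug_inequality f g)].

Definition Ntilde (mu : {outer_measure set X -> \bar R}) :
    set (X -> \bar R) :=
  [set f | [/\ borel_fun_on setT f, Linfty_norm mu f < +oo &
     exists2 g, weak_upper_gradient mu f g & Linfty_norm mu g < +oo]].

Definition Ntilde_norm (mu : {outer_measure set X -> \bar R})
    (f : X -> \bar R) : \bar R :=
  Linfty_norm mu f +
  ereal_inf [set Linfty_norm mu g | g in weak_upper_gradient mu f].

(* The quotient space N^{1,oo}(X) is the set of the equivalence classes; the
   seminorm is constant on each class, so the infimum below is its value at
   any representative. *)
Definition N1infty_class (mu : {outer_measure set X -> \bar R})
    (u : X -> \bar R) : set (X -> \bar R) :=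
  [set v | Ntilde mu v /\ Ntilde_norm mu (u \- v) = 0].

Definition N1infty (mu : {outer_measure set X -> \bar R}) :
    set (set (X -> \bar R)) :=
  [set N1infty_class mu u | u in Ntilde mu].

Definition N1infty_norm (mu : {outer_measure set X -> \bar R})
    (c : set (X -> \bar R)) : \bar R :=
  ereal_inf [set Ntilde_norm mu u | u in c].

Definition Lip (f : X -> R) (x : X) : \bar R :=
  if `[< isolated setT x >] then 0
  else limf_esup (fun y => (`|f x - f y| / mdist x y)%R%:E) x^'.

Definition sup_norm (f : X -> \bar R) : \bar R :=
  ereal_sup [set `|f x| | x in setT].

Definition Dinfty : set (X -> R) :=
  [set f | bounded_fun f /\ sup_norm (Lip f) < +oo].

Definition Dinfty_norm (f : X -> R) : \bar R :=
  maxe (sup_norm (EFin \o f)) (sup_norm (Lip f)).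

Definition average (mu : {outer_measure set X -> \bar R}) (B : set X)
    (u : X -> \bar R) : \bar R :=
  (mu B)^-1 * \int[cara mu]_(x in (B : set (caratheodory_type mu))) u x.

Definition local_weak_poincare (mu : {outer_measure set X -> \bar R})
    (p Cp : R) :=
  forall x : X, exists U : set X, exists lambda : R,
    [/\ nbhs x U, (1 <= lambda)%R &
      forall (y : X) (r : R) (u g : X -> \bar R), (0 < r)%R ->
        let B := ball y r in
        let lB := ball y (lambda * r) in
        lB `<=` U ->
        (cara mu).-integrable (lB : set (caratheodory_type mu)) u ->
        upper_gradient_in lB u g ->
        average mu B (fun z => `|u z - average mu B u|)
          <= (Cp * r)%:E * average mu lB (fun z => g z `^ p) `^ p^-1].

Definition supports_local_weak_poincare
    (mu : {outer_measure set X -> \bar R}) (p : R) :=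
  exists2 Cp : R, (0 < Cp)%R & local_weak_poincare mu p Cp.

End MetricMeasureSpace.
Arguments borelType {R} X.
Arguments curve {R} X.
Arguments Dinfty {R} X.

(* Main.v *)
Require Import Defs.
From HB Require Import structures.
From mathcomp Require Import all_boot all_order all_algebra.
From mathcomp Require Import all_classical all_reals all_analysis measurable_realfun.
From mathcomp Require Import ess_sup_inf.
From mathcomp Require Import ring lra.

Set Implicit Arguments.
Unset Strict Implicit.
Unset Printing Implicit Defensive.

Import Order.TTheory GRing.Theory Num.Theory.
Import numFieldNormedType.Exports.

Local Open Scope classical_set_scope.
Local Open Scope ring_scope.

(** One inclusion holds in every metric measure space: if [Lip f <= L]
    everywhere then [f] composed with a curve grows at most [L] times as fast as
    the length of the curve, so that the constant [L] is an upper gradient of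
    [f] ([Dinfty_lipschitz_along_curves]).

    For the other one, let [g] be a weak upper gradient of [u] with
    [g <= M] almost everywhere.  Modulus zero for the exponent infinity means
    that one null set [Z] meets all the exceptional curves in positive length
    ([Mod_infty_eq0]); enlarging [Z] by the points where [g > M], all that
    remains of [g] is that [u] oscillates by at most [M] times the length on
    every curve that almost avoids [Z] ([lipschitz_along_curves]).  Hence
    the function equal to [M] off [Z] and to [+oo] on [Z] is a genuine upper
    gradient, to which the Poincare inequality applies: on small balls of
    radius [r] the mean oscillation of [u] is at most [Cp * M * r].  By doubling,
    the means of [u] over the balls of radius [2 ^- k] around [x] then form
    a geometrically convergent sequence, whose limit [f x] ([mean_limit])
    satisfies [Lip f <= K * M], with [K] depending on the doubling and Poincare
    constants only: the radii below which this works depend on [x], which is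
    harmless for the pointwise quantity [Lip].

    It remains to compare [f] with [u].  They agree almost everywhere: at points
    whose small balls are under control, the set where [|u - f| >= e] has
    arbitrarily small density in fine balls, by Chebyshev's inequality, and
    a covering of such points by balls whose halves are disjoint turns this
    into a bound of its mass ([density_mass]).  They also agree at the end
    points of almost every curve, since a curve almost avoiding
    [Z] leaves [Z] arbitrarily soon, and neither function can change much in
    between ([eq_along_curve]); this is what equality of the classes of [u] and
    [f] amounts to ([Ntilde_norm_eq0]).  Thus every class contains a function of
    D^oo.  It contains only one, because continuous functions that agree almost
    everywhere are equal; therefore also the construction, applied to any member
    of the class of [f] and any of its weak upper gradients [g], gives [f] back
    and bounds [Lip f] by [K] times the norm of [g], which is the nontrivial
    comparison of the norms. *)

(** * Lengths of curves *)

Lemma within_continuous_ballP (R : realType) (X : pseudoMetricType R)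
    (A : set R) (f : R -> X) :
  {within A, continuous f} <->
  forall t, A t -> forall e, 0 < e -> exists2 d, 0 < d &
    forall s, A s -> `|t - s| < d -> ball (f t) e (f s).
Proof.
split => [/subspace_continuousP cf t At e e0|H].
  have /cvg_ballP/(_ e e0) := cf t At.
  rewrite near_withinE => /nbhs_ballP[d /= d0 dP].
  by exists d => // s As ts; exact: dP.
apply/subspace_continuousP => t At; apply/cvg_ballP => e e0.
have [d d0 dP] := H t At e e0.
rewrite near_withinE; apply/nbhs_ballP; exists d => //= s ts As.
exact: dP.
Qed.

Section CurveLength.
Context {R : realType} {X : pMetricType R}.
Implicit Types (gamma : R -> X) (a b c : R) (s t : seq R).

(** The sum of which [curve_length] is the supremum, as a recursion on the
    partition. *)
Fixpoint polygon_length gamma a s : R :=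
  if s is x :: s' then mdist (gamma a) (gamma x) + polygon_length gamma x s'
  else 0.

Lemma polygon_lengthE gamma a b s :
  (let F := gamma \o nth b (a :: s) in
    \sum_(0 <= n < size s) mdist (F n) (F n.+1)) = polygon_length gamma a s.
Proof.
elim: s a => [|x s ih] a /=; first by rewrite big_nil.
by rewrite big_nat_recl//= -ih.
Qed.

Lemma polygon_length_cat gamma a s t :
  polygon_length gamma a (s ++ t) =
  polygon_length gamma a s + polygon_length gamma (last a s) t.
Proof. by elim: s a => [|x s ih] a /=; rewrite ?add0r// ih addrA. Qed.

Lemma curve_lengthE gamma a b : curve_length gamma a b =
  ereal_sup [set (polygon_length gamma a s)%:E | s in itv_partition a b].
Proof.
rewrite /curve_length; congr ereal_sup.
by apply/seteqP; split => _ [s ps <-]; exists s => //; congr EFin;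
  rewrite -(polygon_lengthE gamma a b).
Qed.

Lemma polygon_length_le gamma a b s : itv_partition a b s ->
  ((polygon_length gamma a s)%:E <= curve_length gamma a b)%E.
Proof. by move=> ps; rewrite curve_lengthE; apply: ereal_sup_ubound; exists s. Qed.

Lemma curve_lengthxx gamma a : curve_length gamma a a = 0%E.
Proof.
rewrite curve_lengthE (_ : [set _ | _ in _] = [set 0%E]) ?ereal_sup1//.
apply/seteqP; split => [_ [s ps <-]|_ ->].
  by rewrite (itv_partitionxx ps).
by exists [::] => //; split => /=.
Qed.

Lemma mdist_le_curve_length gamma a b : a <= b ->
  ((mdist (gamma a) (gamma b))%:E <= curve_length gamma a b)%E.
Proof.
rewrite le_eqVlt => /predU1P[->|ab].
  by rewrite mdistxx curve_lengthxx.
apply: le_trans (polygon_length_le _ (itv_partition1 ab)).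
by rewrite /= addr0.
Qed.

Lemma curve_length_ge0 gamma a b : a <= b -> (0 <= curve_length gamma a b)%E.
Proof.
move=> ab; apply: le_trans (mdist_le_curve_length _ ab).
by rewrite lee_fin mdist_ge0.
Qed.

(** By the triangle inequality, one more vertex on the curve does not shorten an
    inscribed polygon, which can then be cut at that vertex. *)
Lemma split_partition gamma a b c s : a < c -> c < b -> itv_partition a b s ->
  exists s1 s2, [/\ itv_partition a c s1, itv_partition c b s2 &
    polygon_length gamma a s <=
    polygon_length gamma a s1 + polygon_length gamma c s2].
Proof.
move=> + cb; elim: s a => [|x s ih] a ac ps.
  by move: (itv_partition_nil ps) ac => -> /lt_trans/(_ cb); rewrite ltxx.
have [ax xs] : a < x /\ itv_partition x b s.
  by case: ps => /= /andP[ax ps] lb; split.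
have [cx|xc|xc] := ltgtP c x.
- exists [:: c], (x :: s); split => //.
  + exact: itv_partition1.
  + by case: xs => p l; split => //=; rewrite cx.
  + by rewrite /= addr0 addrA lerD2r metric_triangle.
- have [s1 [s2 [p1 p2 le12]]] := ih _ xc xs.
  exists (x :: s1), s2; split => //.
  + by case: p1 => p1 l1; split => //=; rewrite ax.
  + by rewrite /= -addrA lerD2l.
- exists [:: c], s; split; rewrite ?xc//.
  + exact: itv_partition1.
  + by rewrite /= addr0.
Qed.

Lemma curve_length_additive gamma a c b : a <= c -> c <= b ->
  curve_length gamma a b =
  (curve_length gamma a c + curve_length gamma c b)%E.
Proof.
rewrite le_eqVlt => /predU1P[->|ac]; first by rewrite curve_lengthxx add0e.
rewrite le_eqVlt => /predU1P[->|cb]; first by rewrite curve_lengthxx adde0.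
apply/eqP; rewrite eq_le; apply/andP; split.
  rewrite [leLHS]curve_lengthE; apply: ge_ereal_sup => _ [s ps <-].
  have [s1 [s2 [p1 p2 le12]]] := split_partition gamma ac cb ps.
  apply: (@le_trans _ _ (polygon_length gamma a s1 +
    polygon_length gamma c s2)%:E); first by rewrite lee_fin.
  by rewrite EFinD leeD// polygon_length_le.
have c1 := curve_length_ge0 gamma (ltW ac).
have c2 := curve_length_ge0 gamma (ltW cb).
rewrite [in leLHS](curve_lengthE gamma a c).
have [|h] := eqVneq (curve_length gamma c b) +oo%E.
  move=> h; rewrite h addey; last first.
    by rewrite -curve_lengthE; case: curve_length c1.
  rewrite -{}h curve_lengthE; apply: ge_ereal_sup => _ [s ps <-].
  apply: le_trans (polygon_length_le _ (itv_partition_cat (itv_partition1 ac) ps)).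
  by rewrite lee_fin polygon_length_cat/= addr0 lerDr mdist_ge0.
have fcb : curve_length gamma c b \is a fin_num.
  by rewrite ge0_fin_numE// ltey.
rewrite -leeBrDr//; apply: ge_ereal_sup => _ [s1 p1 <-].
rewrite leeBrDr// -leeBrDl// curve_lengthE.
apply: ge_ereal_sup => _ [s2 p2 <-].
rewrite leeBrDl// -EFinD.
have := polygon_length_le gamma (itv_partition_cat p1 p2).
by rewrite polygon_length_cat; case: p1 => _ /eqP ->.
Qed.

(** When the end point of a nearly optimal polygon moves back a little, only its
    last edge changes: hence the left-continuity of the length. *)
Lemma curve_length_last gamma a b : a < b ->
  forall e, (e < curve_length gamma a b)%E ->
  exists2 c, a <= c < b & forall u, c < u -> u <= b ->
    (e < curve_length gamma a u + (mdist (gamma u) (gamma b))%:E)%E.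
Proof.
move=> ab e; rewrite {1}curve_lengthE => /ereal_sup_gt[_ [s ps <-]] es.
case/lastP: s ps es => [/itv_partition_nil abE _|s x ps es].
  by rewrite abE ltxx in ab.
have [xb psl sb] : [/\ x = b, itv_partition a (last a s) s & last a s < b].
  case: ps; rewrite rcons_path last_rcons => /andP[h1 h2] /eqP h3; subst x.
  by split.
subst x; exists (last a s); first by rewrite sb (itv_partition_le psl).
move=> u cu ub; apply: (lt_le_trans es).
rewrite (curve_length_additive _ (itv_partition_le psl) (ltW cu)).
rewrite -cats1 polygon_length_cat /= addr0 EFinD -addeA leeD//.
  exact: polygon_length_le.
apply: (@le_trans _ _ (mdist (gamma (last a s)) (gamma u)
  + mdist (gamma u) (gamma b))%:E); first by rewrite lee_fin metric_triangle.
by rewrite EFinD leeD2r// mdist_le_curve_length// ltW.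
Qed.

(** The counterpart of [curve_length_last] for right-continuity. *)
Lemma curve_length_first gamma a b : a < b ->
  forall e, (e < curve_length gamma a b)%E ->
  exists2 c, a < c <= b & forall u, a <= u -> u < c ->
    (e < (mdist (gamma a) (gamma u))%:E + curve_length gamma u b)%E.
Proof.
move=> ab e; rewrite {1}curve_lengthE => /ereal_sup_gt[_ [[|x s] ps <-]] es.
  by rewrite (itv_partition_nil ps) ltxx in ab.
have [ax xs] : a < x /\ itv_partition x b s.
  by case: ps => /= /andP[ax ps] lb; split.
exists x; first by rewrite ax (itv_partition_le xs).
move=> u au ux; apply: (lt_le_trans es) => /=.
rewrite (curve_length_additive _ (ltW ux) (itv_partition_le xs)).
rewrite EFinD addeA leeD//; last exact: polygon_length_le.
apply: (@le_trans _ _ (mdist (gamma a) (gamma u)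
  + mdist (gamma u) (gamma x))%:E); first by rewrite lee_fin metric_triangle.
by rewrite EFinD leeD2l// mdist_le_curve_length// ltW.
Qed.

End CurveLength.

(** * Arc length *)

Definition travelled {R : realType} {X : pMetricType R} (gamma : curve X)
  (t : R) : R := fine (curve_length gamma (cstart gamma) t).

Section RectifiableCurve.
Context {R : realType} {X : pMetricType R} (gamma : curve X).
Hypothesis rect : rectifiable gamma.
Notation a := (cstart gamma).
Notation b := (cend gamma).
Notation len := (travelled gamma).

Lemma curve_length_fin s t : a <= s -> s <= t -> t <= b ->
  curve_length gamma s t \is a fin_num.
Proof.
move=> As st tb; rewrite ge0_fin_numE ?curve_length_ge0//.
apply: le_lt_trans rect; rewrite /clength.
rewrite (curve_length_additive _ As (le_trans st tb)).
rewrite (curve_length_additive _ st tb) addeCA leeDl//.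
by rewrite adde_ge0// curve_length_ge0.
Qed.

Lemma travelledE s t : a <= s -> s <= t -> t <= b ->
  curve_length gamma s t = (len t - len s)%:E.
Proof.
move=> As st tb; have at_ := le_trans As st.
have sb := le_trans st tb.
have h : (len t)%:E = ((len s)%:E + curve_length gamma s t)%E.
  by rewrite !fineK ?curve_length_fin// -curve_length_additive.
move: h; rewrite -(fineK (curve_length_fin As st tb)) -EFinD.
by move=> [->]; rewrite addrAC subrr add0r.
Qed.

Lemma travelled_start : len a = 0.
Proof. by rewrite /travelled curve_lengthxx. Qed.

Lemma clengthE : clength gamma = (len b)%:E.
Proof.
by rewrite /clength travelledE ?lexx ?cstart_le_cend// travelled_start subr0.
Qed.

Lemma mdist_le_travelled s t : a <= s -> s <= t -> t <= b ->
  mdist (gamma s) (gamma t) <= len t - len s.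
Proof.
by move=> As st tb; rewrite -lee_fin -travelledE// mdist_le_curve_length.
Qed.

Lemma travelled_le s t : a <= s -> s <= t -> t <= b -> len s <= len t.
Proof.
move=> As st tb; rewrite -subr_ge0.
by apply: le_trans (mdist_le_travelled As st tb); rewrite mdist_ge0.
Qed.

Lemma curve_ballP t : a <= t <= b -> forall e, 0 < e -> exists2 d, 0 < d &
  forall s, a <= s <= b -> `|t - s| < d -> mdist (gamma t) (gamma s) < e.
Proof.
move=> tab e e0.
have /within_continuous_ballP/(_ t) := @cmap_continuous _ _ gamma.
rewrite /= in_itv/= => /(_ tab e e0)[d d0 dP]; exists d => // s sab ts.
by have := dP s; rewrite /= in_itv/= ballEmdist => /(_ sab ts).
Qed.

Lemma travelled_right t : a <= t -> t < b -> forall e, 0 < e ->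
  exists2 d, 0 < d & forall u, t <= u -> u <= b -> u < t + d ->
    len u - len t < e.
Proof.
move=> At tb e e0; have e20 : 0 < e / 2 by rewrite divr_gt0.
have tab : a <= t <= b by rewrite At ltW.
have [d d0 dP] := curve_ballP tab e20.
have : ((len b - len t - e / 2)%:E < curve_length gamma t b)%E.
  by rewrite travelledE ?(ltW tb)// lte_fin gtrBl.
move=> /(curve_length_first tb)[c /andP[tc cb] cP].
exists (Num.min d (c - t)) => [|u tu ub].
  by rewrite lt_min d0 subr_gt0.
rewrite -ltrBlDl lt_min => /andP[ud uc].
have := cP u tu; rewrite ltrBlDr subrK in uc; move=> /(_ uc).
rewrite travelledE// ?(le_trans At)// -EFinD lte_fin.
have := dP u; rewrite ub (le_trans At)// distrC ger0_norm ?subr_ge0//.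
move=> /(_ isT ud); lra.
Qed.

Lemma travelled_left t : a < t -> t <= b -> forall e, 0 < e ->
  exists2 d, 0 < d & forall u, a <= u -> u <= t -> t - d < u ->
    len t - len u < e.
Proof.
move=> At tb e e0; have e20 : 0 < e / 2 by rewrite divr_gt0.
have tab : a <= t <= b by rewrite tb ltW.
have [d d0 dP] := curve_ballP tab e20.
have : ((len t - e / 2)%:E < curve_length gamma a t)%E.
  by rewrite travelledE ?(ltW At)// travelled_start subr0 lte_fin gtrBl.
move=> /(curve_length_last At)[c /andP[ac ct] cP].
exists (Num.min d (t - c)) => [|u au ut].
  by rewrite lt_min d0 subr_gt0.
rewrite ltrBlDr -ltrBlDl lt_min => /andP[ud uc].
have cu : c < u by lra.
have ub := le_trans ut tb.
have := cP u cu ut.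
rewrite travelledE// travelled_start subr0 -EFinD lte_fin.
have := dP u; rewrite ub au ger0_norm ?subr_ge0// metric_sym.
move=> /(_ isT ud); lra.
Qed.

Lemma travelled_continuous : {within `[a, b], continuous len}.
Proof.
apply/within_continuous_ballP => t; rewrite /= in_itv/= => /andP[At tb] e e0.
have [d1 d10 d1P] : exists2 d, 0 < d & forall u, t <= u -> u <= b ->
    u < t + d -> len u - len t < e.
  move: tb; rewrite le_eqVlt => /predU1P[<-|tb]; last exact: travelled_right.
  exists 1 => // u tu ut _.
  have -> : u = t by apply/eqP; rewrite eq_le ut tu.
  by rewrite subrr.
have [d2 d20 d2P] : exists2 d, 0 < d & forall u, a <= u -> u <= t ->
    t - d < u -> len t - len u < e.
  move: At; rewrite le_eqVlt => /predU1P[<-|At]; last exact: travelled_left.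
  exists 1 => // u au ua _.
  have -> : u = a by apply/eqP; rewrite eq_le au ua.
  by rewrite subrr.
exists (Num.min d1 d2) => [|u]; first by rewrite lt_min d10 d20.
rewrite in_itv/= => /andP[au ub]; rewrite lt_min => /andP[u1 u2].
rewrite /ball/=; have [tu|/ltW ut] := leP t u.
  have lel := travelled_le At tu ub.
  rewrite distrC ger0_norm ?subr_ge0//; apply: d1P => //.
  by move: u1; rewrite distrC ger0_norm ?subr_ge0// ltrBlDl.
have lel := travelled_le au ut tb.
rewrite ger0_norm ?subr_ge0//; apply: d2P => //.
by move: u2; rewrite ger0_norm ?subr_ge0// ltrBlDr ltrBlDl.
Qed.

(** [arc_param gamma s] is the point of [gamma] at a well defined time, namely
    the greatest one at which the length travelled is [s]: that time exists
    because the length travelled depends continuously on the time. *)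
Lemma arc_paramP s : 0 <= s <= len b -> exists t,
  [/\ a <= t <= b, len t = s, arc_param gamma s = gamma t &
      forall u, a <= u <= b -> len u = s -> u <= t].
Proof.
move=> sl; pose E := [set t | t \in `[a, b] /\ curve_length gamma a t = s%:E].
have EP t : E t <-> a <= t <= b /\ len t = s.
  rewrite /E /= in_itv/=; split => -[/andP[At tb] h]; rewrite At tb.
    by rewrite /travelled h.
  by rewrite travelledE// travelled_start subr0 h.
have E0 : E !=set0.
  have [|c] := IVT (cstart_le_cend gamma) travelled_continuous (v := s).
    rewrite travelled_start; have l0 : 0 <= len b.
      by case/andP: sl; exact: le_trans.
    by rewrite min_l// max_r.
  rewrite in_itv/= => cab cs; exists c; exact/EP.
have Eb : has_ubound E by exists b => t /EP[/andP[]].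
have supE : has_sup E by [].
have tab : a <= sup E <= b.
  case: E0 => c Ec; have /EP[/andP[ac cb] cs] := Ec.
  rewrite (le_trans ac) ?ub_le_sup//=.
  by apply: ge_sup; [exists c|move=> t /EP[/andP[]]].
exists (sup E); split => //; last first.
  by move=> u uab us; rewrite ub_le_sup//; apply/EP.
apply/eqP; rewrite -subr_eq0 -normr_le0; apply/ler_addgt0Pl => e e0.
have /within_continuous_ballP/(_ (sup E)) := travelled_continuous.
rewrite /= in_itv/= => /(_ tab e e0)[d d0 dP].
have [u Eu ud] := sup_adherent d0 supE.
have /EP[uab us] := Eu.
have := dP u; rewrite /= in_itv/= uab => /(_ isT).
rewrite ger0_norm ?subr_ge0 ?ub_le_sup// ltrBlDr -ltrBlDl => /(_ ud).
by rewrite /ball/= us addr0 => /ltW.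
Qed.

Lemma arc_param_eq s t : 0 <= s <= len b -> a <= t <= b -> len t = s ->
  (forall u, a <= u <= b -> len u = s -> u <= t) ->
  arc_param gamma s = gamma t.
Proof.
move=> sl tab ts tmax; have [u [uab us -> umax]] := arc_paramP sl.
by congr (gamma _); apply/eqP; rewrite eq_le tmax// umax.
Qed.

Lemma mdist_arc_param s s' : 0 <= s -> s <= s' -> s' <= len b ->
  mdist (arc_param gamma s) (arc_param gamma s') <= s' - s.
Proof.
move=> s0 ss' s'l.
have [|t [/andP[At tb] st -> tmax]] := @arc_paramP s.
  by rewrite s0 (le_trans ss').
have [|t' [/andP[at' t'b] ts -> tmax']] := @arc_paramP s'.
  by rewrite s'l (le_trans s0).
rewrite -ts -st; have [tt'|/ltW t't] := leP t t'; first exact: mdist_le_travelled.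
have h := travelled_le at' t't tb.
have e : len t = len t' by lra.
by rewrite metric_sym e; apply: le_trans (mdist_le_travelled at' t't tb) _;
  rewrite e.
Qed.

Lemma arc_param_continuous :
  {within `[0, len b], continuous (arc_param gamma)}.
Proof.
apply/within_continuous_ballP => t; rewrite /= in_itv/= => /andP[t0 tb] e e0.
exists e => // s; rewrite in_itv/= => /andP[s0 sb]; rewrite ballEmdist/=.
apply: le_lt_trans; have [ts|/ltW st] := leP t s.
  by rewrite distrC ger0_norm ?subr_ge0// mdist_arc_param.
by rewrite ger0_norm ?subr_ge0// metric_sym mdist_arc_param.
Qed.

Lemma measurable_arc_param :
  measurable_fun `[0, len b] (arc_param gamma : _ -> borelType X).
Proof.
apply: (@measurability _ _ _ (borelType X) _ _ (@open X)) => // _ [U oU <-].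
apply: open_measurable_subspace => //.
by have /continuousP := arc_param_continuous; exact.
Qed.

End RectifiableCurve.

(** * Line integrals *)

Section Translation.
Context {R : realType}.

(** Needed because the arc length parametrization of a subcurve is a translate of
    that of the whole curve. *)
Lemma lebesgue_measure_translate (c : R) (A : set R) : measurable A ->
  lebesgue_measure [set x | A (x + c)] = lebesgue_measure A.
Proof.
move=> mA; have mc : measurable_fun [set: R]
    ((fun x => x + c) : R -> measurableTypeR R).
  exact: measurable_funD.
pose phi : {mfun R >-> measurableTypeR R} :=
  HB.pack (fun x : R => x + c) (isMeasurableFun.Build _ _ _ _ _ mc).
apply/esym; rewrite -[RHS]/(pushforward lebesgue_measure phi A).
apply: lebesgue_measure_unique => //= _ [[a b]] _ <-.
rewrite /pushforward (_ : _ @^-1` _ = `]a - c, b - c]%classic); last first.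
  by apply/seteqP; split => x /=; rewrite !in_itv/= => /andP[? ?];
    apply/andP; split; lra.
rewrite !lebesgue_measure_itv/= !lte_fin ltrD2r.
by case: ifP => // _; rewrite -!EFinB; congr EFin; ring.
Qed.
End Translation.

Section LineIntegral.
Context {R : realType} {X : pMetricType R}.
Implicit Types (gamma : curve X) (Z : set X) (g : X -> \bar R) (M : R).

(** The curve may meet [Z], but its arc length measure does not see it. *)
Definition avoids Z gamma := lebesgue_measure
  (`[0, travelled gamma (cend gamma)] `&` arc_param gamma @^-1` Z) = 0%E.

(** For a null set [Z], this function is as good as the constant [M] for the
    integrals over [X], while its integral along a curve that does not avoid [Z]
    is infinite, so that it imposes nothing on such curves. *)
Definition penalty Z M : X -> \bar R :=
  fun x => if x \in Z then +oo%E else M%:E.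

Lemma penalty_ge0 Z M x : 0 <= M -> (0 <= penalty Z M x)%E.
Proof. by move=> M0; rewrite /penalty; case: ifP; rewrite ?lee_fin. Qed.

Lemma penalty_ge Z M x : (M%:E <= penalty Z M x)%E.
Proof. by rewrite /penalty; case: ifP; rewrite ?leey. Qed.

Lemma penalty_in Z M x : Z x -> penalty Z M x = +oo%E.
Proof. by move=> Zx; rewrite /penalty mem_set. Qed.

Lemma penalty_out Z M x : ~ Z x -> penalty Z M x = M%:E.
Proof. by move=> Zx; rewrite /penalty memNset. Qed.

Lemma borel_penalty Z M A : borel_set Z -> borel_fun_on A (penalty Z M).
Proof.
move=> mZ; apply: measurable_funTS; apply: measurable_fun_ifT => //=.
apply: measurable_fun_bool => //; rewrite setTI (_ : _ @^-1` _ = Z)//.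
by apply/seteqP; split => x /=; [move/set_mem|move/mem_set].
Qed.

Lemma travelled_end_ge0 gamma : 0 <= travelled gamma (cend gamma).
Proof. by rewrite fine_ge0// curve_length_ge0// cstart_le_cend. Qed.

Lemma measurable_arc_preimage Z gamma : borel_set Z -> rectifiable gamma ->
  measurable (`[0, travelled gamma (cend gamma)] `&` arc_param gamma @^-1` Z).
Proof. by move=> mZ rg; exact: measurable_arc_param. Qed.

Lemma measurable_line_integrand gamma g : rectifiable gamma ->
  borel_fun_on setT g ->
  measurable_fun `[0, travelled gamma (cend gamma)]
    (fun s => g (arc_param gamma s)).
Proof.
move=> rg mg; apply: (@measurable_comp _ _ _ _ (borelType X) _ setT) => //.
exact: measurable_arc_param.
Qed.

Lemma line_integral_cst gamma M : rectifiable gamma ->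
  line_integral gamma (cst M%:E) = (M%:E * clength gamma)%E.
Proof.
move=> rg; rewrite /line_integral integral_cst//= lebesgue_measure_itv/=.
rewrite clengthE//= lte_fin; case: ltP => [_|h]; first by rewrite oppr0 adde0.
by congr (_ * _)%E; apply/eqP; rewrite eqe eq_le h travelled_end_ge0.
Qed.

Lemma line_integral_le gamma g h : rectifiable gamma ->
  borel_fun_on setT g -> borel_fun_on setT h ->
  (forall x, 0 <= g x)%E -> (forall x, g x <= h x)%E ->
  (line_integral gamma g <= line_integral gamma h)%E.
Proof.
move=> rg mg mh g0 gh; apply: ge0_le_integral => //.
- exact: measurable_line_integrand.
- exact: measurable_line_integrand.
Qed.

Lemma line_integral_ge gamma g M : rectifiable gamma ->
  borel_fun_on setT g -> 0 <= M -> (forall x, M%:E <= g x)%E ->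
  (M%:E * clength gamma <= line_integral gamma g)%E.
Proof.
move=> rg mg M0 Mg; rewrite -line_integral_cst//.
by apply: line_integral_le => //; exact: measurable_cst.
Qed.

Lemma line_integral_avoids gamma Z g M : rectifiable gamma ->
  borel_set Z -> avoids Z gamma ->
  borel_fun_on setT g -> (forall x, 0 <= g x)%E -> 0 <= M ->
  (forall x, ~ Z x -> g x <= M%:E)%E ->
  (line_integral gamma g <= M%:E * clength gamma)%E.
Proof.
move=> rg mZ aZ mg g0 M0 gM; rewrite -line_integral_cst//.
apply: ae_ge0_le_integral => //.
- exact: measurable_line_integrand.
exists (`[0, travelled gamma (cend gamma)] `&` arc_param gamma @^-1` Z).
split => //; first exact: measurable_arc_preimage.
move=> s /= /not_implyP[sl /negP]; rewrite -ltNge => h; split => //.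
by apply: contrapT => /gM; rewrite leNgt h.
Qed.

Lemma line_integral_Navoids gamma Z g : rectifiable gamma ->
  borel_set Z -> ~ avoids Z gamma ->
  borel_fun_on setT g -> (forall x, 0 <= g x)%E ->
  (forall x, Z x -> g x = +oo)%E ->
  line_integral gamma g = +oo%E.
Proof.
move=> rg mZ aZ mg g0 gZ.
have mA := measurable_arc_preimage mZ rg.
apply/eqP; rewrite -leye_eq.
set A := _ `&` _ in mA.
have h : (\int[lebesgue_measure]_(s in A) g (arc_param gamma s) <=
    line_integral gamma g)%E.
  apply: ge0_subset_integral => //; first exact: measurable_line_integrand.
  exact: subIsetl.
apply: le_trans h.
rewrite (eq_integral (cst +oo%E)); last by move=> s /set_mem[_ /gZ].
rewrite integral_cst// gt0_mulye// lt0e measure_ge0 andbT.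
exact/eqP.
Qed.

End LineIntegral.

(** * Subcurves *)

Section Subcurve.
Context {R : realType} {X : pMetricType R}.
Implicit Types (gamma : curve X) (Z : set X).

Lemma subcurve_continuous gamma s t : cstart gamma <= s -> t <= cend gamma ->
  {within `[s, t], continuous gamma}.
Proof.
move=> As tb; apply: continuous_subspaceW (@cmap_continuous _ _ gamma).
by move=> u /=; rewrite !in_itv/= => /andP[/(le_trans As)-> /le_trans->].
Qed.

Definition subcurve gamma s t (As : cstart gamma <= s) (st : s <= t)
  (tb : t <= cend gamma) : curve X := Curve st (subcurve_continuous As tb).

Section fixed_subcurve.
Variables (gamma : curve X) (s t : R).
Hypotheses (rect : rectifiable gamma) (As : cstart gamma <= s) (st : s <= t)
  (tb : t <= cend gamma).
Notation sub := (subcurve As st tb).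
Notation len := (travelled gamma).

Lemma clength_subcurve : clength sub = (len t - len s)%:E.
Proof. exact: (travelledE rect As st tb). Qed.

Lemma rectifiable_subcurve : rectifiable sub.
Proof. by rewrite /rectifiable clength_subcurve ltry. Qed.

Lemma travelled_subcurve u : s <= u -> u <= t ->
  travelled sub u = len u - len s.
Proof.
move=> su ut; rewrite {1}/travelled [curve_length _ _ _](travelledE rect As su)//.
exact: le_trans tb.
Qed.

(** At [r = len t - len s] the two sides may differ, as [gamma] may rest after
    the time [t] and [arc_param] selects the last possible time. *)
Lemma arc_param_subcurve r : 0 <= r -> r < len t - len s ->
  arc_param sub r = arc_param gamma (len s + r).
Proof.
move=> r0 rl; have rlsub : 0 <= r <= travelled sub (cend sub).
  by rewrite r0/= travelled_subcurve ?lexx//= ltW.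
have [u [/andP[/= su ut] lu -> umax]] := arc_paramP rectifiable_subcurve rlsub.
rewrite travelled_subcurve// in lu.
have sb := le_trans st tb; have at_ := le_trans As st.
have ls0 : 0 <= len s.
  by rewrite -(travelled_start gamma) travelled_le// lexx.
apply/esym/arc_param_eq => //.
- have := travelled_le rect at_ tb (lexx _); lra.
- by rewrite (le_trans As su) (le_trans ut tb).
- lra.
move=> v /andP[av vb] lv; have [sv|/ltW vs] := leP s v; last exact: le_trans su.
have [vt|/ltW tv] := leP v t.
  by apply: umax; rewrite /= ?sv// travelled_subcurve// lv; lra.
have := travelled_le rect at_ tv vb; lra.
Qed.

(** Up to its end point, the part of a subcurve in [Z] is a translate of a piece
    of the part of [gamma] in [Z]. *)
Lemma avoids_subcurve Z : borel_set Z -> avoids Z gamma -> avoids Z sub.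
Proof.
move=> mZ aZ; have msub := measurable_arc_preimage mZ rectifiable_subcurve.
pose A : set R := `[0, len (cend gamma)] `&` arc_param gamma @^-1` Z.
have mA : measurable A by exact: measurable_arc_preimage.
pose B := [set r | A (r + len s)].
have mB : measurable B.
  rewrite -[B]setTI.
  suff : measurable_fun [set: R] (fun x => x + len s) by exact.
  exact: measurable_funD.
(* [B] is the part of [gamma] in [Z], in the arc length of the subcurve. *)
have lB : lebesgue_measure B = 0%E by rewrite lebesgue_measure_translate.
have l0 : (lebesgue_measure (B `|` [set len t - len s]%R) <= 0)%E.
  apply: (le_trans (measureU2 _ _ _)) => //.
  have /= -> := lebesgue_measure_set1 (len t - len s).
  by move: lB => /= ->; rewrite adde0.
apply/eqP; rewrite -measure_le0; apply: le_trans l0.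
apply: le_measure; rewrite ?inE//; first exact: measurableU.
move=> r [/=]; rewrite in_itv/= travelled_subcurve ?lexx// => /andP[r0].
rewrite le_eqVlt => /predU1P[->|rl] Zr; first by right.
left; rewrite /B /A /=.
have {}Zr : Z (arc_param sub r) by [].
rewrite arc_param_subcurve// in Zr.
rewrite addrC; split => //; rewrite in_itv/=.
have ls0 : 0 <= len s.
  by rewrite -(travelled_start gamma) travelled_le// ?lexx// (le_trans st).
have := travelled_le rect (le_trans As st) tb (lexx _).
by rewrite addr_ge0//=; lra.
Qed.

End fixed_subcurve.
End Subcurve.

(** * Functions with bounded oscillation along curves *)

Section AlmostEveryCurve.
Context {R : realType} {X : pMetricType R}.
Implicit Types (gamma : curve X) (Z : set X) (u : X -> \bar R) (f : X -> R).

(** All that is retained of a weak upper gradient with essential supremum at most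
    [M]: the set [Z] accounts for the exceptional curves. *)
Definition lipschitz_along_curves Z (M : R) u := forall gamma,
  Upsilon gamma -> avoids Z gamma ->
  (`|u (gamma (cstart gamma)) - u (gamma (cend gamma))|
    <= M%:E * clength gamma)%E.

Lemma nonconstant_end_gt0 gamma : Upsilon gamma ->
  0 < travelled gamma (cend gamma).
Proof.
move=> [rg [s [t []]]].
wlog st : s t / s <= t => [h|].
  have [st|/ltW ts] := leP s t; first exact: h.
  by move=> sab tab; rewrite eq_sym; apply: h.
rewrite !in_itv/= => /andP[As sb] /andP[at_ tb]; rewrite -mdist_gt0 => d0.
have := mdist_le_travelled rg As st tb.
have := travelled_le rg (lexx _) As sb; rewrite travelled_start.
have := travelled_le rg at_ tb (lexx _).
lra.
Qed.

(** The lengths travelled at the times considered fill an interval, which is not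
    null as a nonconstant curve has positive length. *)
Lemma exists_time_avoiding Z gamma t e : borel_set Z -> Upsilon gamma ->
  avoids Z gamma -> cstart gamma <= t <= cend gamma -> 0 < e ->
  exists2 u, cstart gamma <= u <= cend gamma &
    ~ Z (gamma u) /\ `|travelled gamma u - travelled gamma t| <= e.
Proof.
move=> mZ Ug aZ /andP[At tb] e0; have [rg _] := Ug.
have l0 := nonconstant_end_gt0 Ug.
have lt0 : 0 <= travelled gamma t.
  by rewrite -(travelled_start gamma) travelled_le// lexx.
have ltl := travelled_le rg At tb (lexx _).
pose lo := Num.max 0 (travelled gamma t - e).
pose hi := Num.min (travelled gamma (cend gamma)) (travelled gamma t + e).
have lohi : lo < hi.
  by rewrite gt_max !lt_min l0/=; apply/and3P; split; lra.
have [r [rlohi Zr]] : exists r, r \in `[lo, hi] /\ ~ Z (arc_param gamma r).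
  apply: contrapT => /forallNP h.
  have : (lebesgue_measure (`[lo, hi]%classic : set R) <= 0)%E.
    rewrite -aZ; apply: le_measure; rewrite ?inE//.
      exact: measurable_arc_preimage.
    move=> r /=; rewrite in_itv/= => /andP[lr rh].
    have rl : r \in `[lo, hi] by rewrite in_itv/= lr.
    move: (h r) => /not_andP[//|/contrapT Zr]; split => //.
    move: lr rh; rewrite ge_max le_min in_itv/=.
    by move=> /andP[-> _] /andP[-> _].
  by rewrite lebesgue_measure_itv/= lte_fin lohi -EFinB lee_fin subr_le0 leNgt lohi.
move: rlohi; rewrite in_itv/= ge_max le_min => /andP[/andP[r0 tr] /andP[rl rt]].
have [|u [uab lu ru _]] := @arc_paramP _ _ _ rg r; first by rewrite r0.
exists u => //; rewrite -ru; split => //.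
by rewrite lu ler_distlC; apply/andP; split; lra.
Qed.

Lemma lipschitz_along_subcurve Z M u gamma s t : borel_set Z ->
  lipschitz_along_curves Z M u -> Upsilon gamma -> avoids Z gamma ->
  cstart gamma <= s -> s <= t -> t <= cend gamma -> gamma s != gamma t ->
  (`|u (gamma s) - u (gamma t)|
    <= (M * (travelled gamma t - travelled gamma s))%:E)%E.
Proof.
move=> mZ Lu [rg _] aZ As st tb gst.
rewrite EFinM -(clength_subcurve rg As st tb).
apply: (Lu (subcurve As st tb)); last exact: avoids_subcurve.
split; first exact: rectifiable_subcurve.
by exists s, t; split => //; rewrite in_itv/= lexx st.
Qed.

Lemma abse_subC (x y : \bar R) : (`|x - y| = `|y - x|)%E.
Proof. by case: x y => [x| |] [y| |] //=; rewrite distrC. Qed.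

(** Arbitrarily close to any of its points, a curve avoiding [Z] has points off
    [Z], at which [u] and [f] agree, and in between [u] and [f] change little. *)
Lemma eq_along_curve Z M L u f gamma t : borel_set Z ->
  (forall x, ~ Z x -> u x = (f x)%:E) ->
  lipschitz_along_curves Z M u -> lipschitz_along_curves Z L (EFin \o f) ->
  0 <= M -> 0 <= L ->
  Upsilon gamma -> avoids Z gamma -> cstart gamma <= t <= cend gamma ->
  u (gamma t) = (f (gamma t))%:E.
Proof.
move=> mZ uf Lu Lf M0 L0 Ug aZ tab.
have close e : 0 < e ->
    (`|u (gamma t) - (f (gamma t))%:E| <= ((M + L) * e)%:E)%E.
  move=> e0.
  have [s sab [/uf us st]] := exists_time_avoiding mZ Ug aZ tab e0.
  (* The arc between two equal points may be constant and is not covered by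
     [lipschitz_along_curves]. *)
  have [gE|gN] := eqVneq (gamma t) (gamma s).
    by rewrite gE us -EFinB subrr abse0 lee_fin mulr_ge0 ?addr_ge0// ltW.
  have along v K : 0 <= K -> lipschitz_along_curves Z K v ->
      (`|v (gamma t) - v (gamma s)| <= (K * e)%:E)%E.
    move=> K0 Lv; have [ts|/ltW ts] := leP t s.
      apply: (le_trans (lipschitz_along_subcurve mZ Lv Ug aZ _ ts _ gN)).
      - by case/andP: tab.
      - by case/andP: sab.
      by rewrite lee_fin ler_wpM2l// (le_trans (ler_norm _)).
    rewrite abse_subC; rewrite eq_sym in gN.
    apply: (le_trans (lipschitz_along_subcurve mZ Lv Ug aZ _ ts _ gN)).
    - by case/andP: sab.
    - by case/andP: tab.
    by rewrite lee_fin ler_wpM2l// (le_trans (ler_norm _))// distrC.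
  have := along _ _ L0 Lf; have := along _ _ M0 Lu; rewrite us /=.
  case: (u (gamma t)) => [x| |]//=; rewrite !lee_fin => h1 h2.
  rewrite mulrDl (le_trans (ler_distD (f (gamma s)) _ _))// lerD//.
  by rewrite distrC.
have : (`|u (gamma t) - (f (gamma t))%:E| <= 0)%E.
  apply/lee_addgt0Pr => e e0; rewrite add0e.
  have ML : 0 < M + L + 1 by rewrite ltr_wpDl// addr_ge0.
  apply: (le_trans (close (e / (M + L + 1)) _)); first by rewrite divr_gt0.
  by rewrite lee_fin mulrA ler_pdivrMr// mulrC ler_pM2l// lerDl.
case: (u (gamma t)) => [x| |]//=; rewrite lee_fin normr_le0 subr_eq0.
by move=> /eqP ->.
Qed.

(** Let [T] be the supremum of the times up to which the estimate holds. The
    pointwise estimate at [gamma T] shows that it holds up to [T], using times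
    before [T], and then that [T] is the end of the curve, using times after [T]. *)
Lemma pointwise_lipschitz_along_curve f (L : R) gamma : 0 <= L ->
  (forall x, exists2 d, 0 < d &
    forall y, mdist x y < d -> `|f x - f y| <= L * mdist x y) ->
  rectifiable gamma ->
  `|f (gamma (cstart gamma)) - f (gamma (cend gamma))|
    <= L * travelled gamma (cend gamma).
Proof.
move=> L0 Lf rg; set a := cstart gamma; set b := cend gamma.
have ab : a <= b by exact: cstart_le_cend.
pose S := [set t | a <= t <= b /\
  `|f (gamma a) - f (gamma t)| <= L * travelled gamma t].
have Sa : S a by rewrite /S /= lexx ab subrr normr0 travelled_start mulr0.
have Sub : has_ubound S by exists b => t [/andP[]].
have supS : has_sup S by split => //; exists a.
set T := sup S.
have Tab : a <= T <= b.
  rewrite ub_le_sup//=; apply: ge_sup; first by exists a.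
  by move=> t [/andP[]].
have [aT Tb] := andP Tab.
have [d d0 dP] := Lf (gamma T).
have [e e0 eP] := curve_ballP Tab d0.
have fT t : a <= t <= b -> `|T - t| < e ->
    `|f (gamma T) - f (gamma t)| <= L * mdist (gamma T) (gamma t).
  by move=> tab tT; apply: dP; apply: eP.
have ST : `|f (gamma a) - f (gamma T)| <= L * travelled gamma T.
  have [t St tT] := sup_adherent e0 supS.
  have [/andP[at_ tb] ft] := St; have tT' : t <= T by exact: ub_le_sup.
  rewrite (le_trans (ler_distD (f (gamma t)) _ _))//.
  have := fT t; rewrite at_ tb => /(_ isT).
  rewrite ger0_norm ?subr_ge0//.
  rewrite ltrBlDr -ltrBlDl => /(_ tT) fTt.
  rewrite -[travelled gamma T](subrK (travelled gamma t)) mulrDr addrC lerD//.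
  rewrite distrC (le_trans fTt)// ler_wpM2l// metric_sym.
  exact: mdist_le_travelled.
have [TE|TN] := eqVneq T b; first by rewrite TE in ST.
have Tltb : T < b by rewrite lt_neqAle TN.
pose t := Num.min b (T + e / 2).
have Tt : T < t by rewrite lt_min Tltb ltrDl divr_gt0.
have tb : t <= b by rewrite ge_min lexx.
suff : S t by move=> /(ub_le_sup Sub); rewrite leNgt Tt.
have tab : a <= t <= b by rewrite tb (le_trans aT)// ltW.
split => //; rewrite (le_trans (ler_distD (f (gamma T)) _ _))//.
have : `|T - t| < e.
  rewrite distrC ger0_norm ?subr_ge0 ?(ltW Tt)// ltrBlDl.
  apply: (@le_lt_trans _ _ (T + e / 2)); first by rewrite ge_min lexx orbT.
  by rewrite ltrD2l gtr_pMr// invf_lt1// ltr1n.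
move=> /(fT t tab) fTt.
rewrite -[travelled gamma t](subrK (travelled gamma T)) mulrDr addrC lerD//.
by rewrite (le_trans fTt)// ler_wpM2l// mdist_le_travelled// ltW.
Qed.

End AlmostEveryCurve.

(** * Bounded weak upper gradients *)

Section WeakUpperGradients.
Context {R : realType} {X : pMetricType R}.
Variable mu : {outer_measure set X -> \bar R}.
Hypotheses (mu_regular : borel_regular mu) (mu_nontrivial : (0 < mu setT)%E).
Implicit Types (gamma : curve X) (Z : set X) (u g w : X -> \bar R) (f : X -> R).
Local Open Scope ereal_scope.

Definition borel_null Z := borel_set Z /\ mu Z = 0.

Lemma borel_null0 : borel_null set0.
Proof. by split; [exact: measurable0|exact: outer_measure0]. Qed.

Lemma borel_null_bigcup (Z : nat -> set X) : (forall n, borel_null (Z n)) ->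
  borel_null (\bigcup_n Z n).
Proof.
move=> nZ; split; first by apply: bigcup_measurable => n _; case: (nZ n).
apply/eqP; rewrite eq_le outer_measure_ge0 andbT.
apply: le_trans (outer_measure_sigma_subadditive mu Z) _.
by rewrite eseries0// => n _ _; case: (nZ n).
Qed.

Lemma borel_nullU Z1 Z2 : borel_null Z1 -> borel_null Z2 ->
  borel_null (Z1 `|` Z2).
Proof.
move=> [m1 n1] [m2 n2]; split; first exact: measurableU.
apply/eqP; rewrite eq_le outer_measure_ge0 andbT.
by apply: le_trans (outer_measureU2 mu Z1 Z2) _; rewrite n1 n2 adde0.
Qed.

Lemma borel_measurable_cara A : borel_set A ->
  measurable (A : set (caratheodory_type mu)).
Proof. exact: mu_regular.1. Qed.

Lemma borel_fun_cara u : borel_fun_on setT u ->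
  measurable_fun [set: caratheodory_type mu] u.
Proof.
move=> mu_ _ B mB; apply: borel_measurable_cara; exact: mu_.
Qed.

(** Regularity of [mu] provides null sets that are Borel, hence have measurable
    preimages under [arc_param]. *)
Lemma aeP (P : X -> Prop) :
  {ae cara mu, forall x, P x} <->
  exists2 Z, borel_null Z & forall x, ~ Z x -> P x.
Proof.
split=> [[N [mN N0 PN]]|[Z [mZ Z0] PZ]].
  have [B [mB NB BE]] := mu_regular.2 N.
  exists B; first by split => //; rewrite -BE.
  by move=> x Bx; apply: contrapT => Px; apply/Bx/NB/PN.
exists Z; split => //; first exact: borel_measurable_cara.
by move=> x Px; apply: contrapT => /PZ.
Qed.

Lemma Linfty_normE u : Linfty_norm mu u = ess_sup (cara mu) (abse \o u).
Proof. by rewrite /Linfty_norm unlock ifT. Qed.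

Lemma Linfty_normP u (M : \bar R) : Linfty_norm mu u <= M <->
  exists2 Z, borel_null Z & forall x, ~ Z x -> `|u x| <= M.
Proof.
rewrite Linfty_normE; split => [/ess_supP/aeP//|h].
by apply/ess_supP/aeP.
Qed.

Lemma Linfty_norm_ge0 u : 0 <= Linfty_norm mu u.
Proof. exact: Lnorm_ge0. Qed.

Lemma Linfty_norm_cst (M : R) : (0 <= M)%R -> Linfty_norm mu (cst M%:E) = M%:E.
Proof.
move=> M0; rewrite Linfty_normE (_ : _ \o _ = cst M%:E) ?ess_sup_cst//.
by apply/funext => x /=; rewrite ger0_norm.
Qed.

Lemma avoidsS Z Z' gamma : rectifiable gamma -> borel_set Z -> borel_set Z' ->
  Z `<=` Z' -> avoids Z' gamma -> avoids Z gamma.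
Proof.
move=> rg mZ mZ' ZZ' aZ'; apply/eqP; rewrite -measure_le0 -aZ'.
apply: le_measure; rewrite ?inE.
- exact: measurable_arc_preimage.
- exact: measurable_arc_preimage.
by move=> s [sl /ZZ'].
Qed.

Lemma lipschitz_along_curvesS Z Z' (M : R) u : borel_set Z -> borel_set Z' ->
  Z `<=` Z' -> lipschitz_along_curves Z M u -> lipschitz_along_curves Z' M u.
Proof.
move=> mZ mZ' ZZ' Lu gamma Ug aZ'; apply: Lu => //.
by apply: (avoidsS _ mZ mZ') => //; case: Ug.
Qed.

(** Let [rho] be admissible with norm less than [1 / (n + 1)], for each [n], and
    [Z] be the null set where one of these functions exceeds [1 / (n + 1)]. On a
    curve of length [l] that avoids [Z] the integral of [rho] is at most
    [l / (n + 1)], which is less than [1] for large [n]. *)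
Lemma Mod_infty_eq0 (Gamma : set (curve X)) : Mod_infty mu Gamma = 0 ->
  Gamma `<=` Upsilon ->
  exists2 Z, borel_null Z & forall gamma, Gamma gamma -> ~ avoids Z gamma.
Proof.
move=> Mod0 GU.
have /choice[Z ZP] (n : nat) : exists Z, borel_null Z /\
    exists rho, [/\ borel_fun_on setT rho, forall x, 0 <= rho x,
      forall gamma, Gamma gamma -> 1 <= line_integral gamma rho &
      forall x, ~ Z x -> rho x <= (n.+1%:R^-1)%:E].
  have : Mod_infty mu Gamma < (n.+1%:R^-1)%:E by rewrite Mod0 lte_fin invr_gt0.
  move=> /ereal_inf_lt[_ [rho [mrho rho0 Grho] <-]] /ltW /Linfty_normP[Z nZ rhoZ].
  exists Z; split => //; exists rho; split => // x /rhoZ.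
  by rewrite gee0_abs.
have nZ : borel_null (\bigcup_n Z n).
  by apply: borel_null_bigcup => n; case: (ZP n).
exists (\bigcup_n Z n) => // gamma Gg aZ; have [rg _] := GU _ Gg.
have l0 : (0 <= travelled gamma (cend gamma))%R := travelled_end_ge0 gamma.
pose n := Num.trunc (travelled gamma (cend gamma)).
have ln : (travelled gamma (cend gamma) < n.+1%:R)%R by rewrite truncnS_gt.
have [nZn [rho [mrho rho0 Grho rhoZ]]] := ZP n.
have : line_integral gamma rho <= (n.+1%:R^-1)%:E * clength gamma.
  apply: (line_integral_avoids rg nZ.1 aZ) => //.
  by move=> x Zx; apply: rhoZ => Znx; apply: Zx; exists n.
rewrite clengthE// leNgt => /negP; apply; apply: lt_le_trans (Grho _ Gg).
by rewrite -EFinM lte_fin mulrC ltr_pdivrMr// mul1r.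
Qed.

(** The function equal to [+oo] on [Z] and to [0] elsewhere is admissible, and its
    norm is [0]. *)
Lemma Mod_infty_Navoids Z : borel_null Z ->
  Mod_infty mu [set gamma | Upsilon gamma /\ ~ avoids Z gamma] = 0.
Proof.
move=> [mZ Z0]; apply/eqP; rewrite eq_le; apply/andP; split.
  apply: ereal_inf_le; exists (Linfty_norm mu (penalty Z 0%R)).
    exists (penalty Z 0%R) => //; split.
    - exact: borel_penalty.
    - by move=> x; exact: penalty_ge0.
    move=> gamma [[rg _] aZ]; rewrite (line_integral_Navoids rg mZ aZ) ?leey//.
    - exact: borel_penalty.
    - by move=> x; exact: penalty_ge0.
    - exact: penalty_in.
  apply/Linfty_normP; exists Z => // x Zx.
  by rewrite penalty_out// abse0.
by apply/ereal_infP => _ [rho _ <-]; exact: Linfty_norm_ge0.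
Qed.

(** Curves along which the inequality fails, or of which a non-null part lies
    where [g > M], meet a fixed null set in positive length. *)
Lemma weak_upper_gradient_lipschitz u g (M : R) : (0 <= M)%R ->
  weak_upper_gradient mu u g -> Linfty_norm mu g <= M%:E ->
  exists2 Z, borel_null Z & lipschitz_along_curves Z M u.
Proof.
move=> M0 [mg g0 [Gamma [GU Mod0 ugP]]] /Linfty_normP[Z1 nZ1 gZ1].
have [Z2 nZ2 GZ2] := Mod_infty_eq0 Mod0 GU.
have nZ := borel_nullU nZ1 nZ2.
exists (Z1 `|` Z2) => // gamma Ug aZ; have [rg _] := Ug.
have aZ2 : avoids Z2 gamma.
  by apply: (avoidsS rg nZ2.1 nZ.1) => // x; right.
apply: (@le_trans _ _ (line_integral gamma g)).
  by apply: ugP; split => // /GZ2.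
apply: (line_integral_avoids rg nZ.1 aZ) => //.
move=> x Zx; have := gZ1 x; rewrite gee0_abs//; apply => Z1x.
by apply: Zx; left.
Qed.

Lemma lipschitz_weak_upper_gradient u (M : R) Z : (0 <= M)%R ->
  borel_null Z -> lipschitz_along_curves Z M u ->
  weak_upper_gradient mu u (cst M%:E).
Proof.
move=> M0 nZ Lu; split.
- exact: measurable_cst.
- by move=> x; rewrite lee_fin.
exists [set gamma | Upsilon gamma /\ ~ avoids Z gamma]; split.
- by move=> ? [].
- exact: Mod_infty_Navoids.
move=> gamma [Ug /not_andP[//|/contrapT aZ]].
rewrite /ug_inequality line_integral_cst; first exact: Lu.
by case: Ug.
Qed.

Lemma weak_upper_gradients_ge0 u :
  0 <= ereal_inf [set Linfty_norm mu g | g in weak_upper_gradient mu u].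
Proof. by apply/ereal_infP => _ [g _ <-]; exact: Linfty_norm_ge0. Qed.

Lemma Ntilde_norm_ge0 u : 0 <= Ntilde_norm mu u.
Proof. by rewrite adde_ge0 ?Linfty_norm_ge0// weak_upper_gradients_ge0. Qed.

(** The functions of seminorm zero, see [Ntilde_norm_eq0]. Vanishing almost
    everywhere is less, as the end points of many curves may lie in [Z]. *)
Definition vanishes_along_curves w := exists2 Z, borel_null Z &
  (forall x, ~ Z x -> w x = 0) /\
  forall gamma, Upsilon gamma -> avoids Z gamma ->
    w (gamma (cstart gamma)) = 0 /\ w (gamma (cend gamma)) = 0.

(** If the seminorm is zero then [w] vanishes almost everywhere and oscillates,
    along almost every curve, by at most the length: by [eq_along_curve] it
    vanishes along these curves. *)
Lemma Ntilde_norm_eq0 w : Ntilde_norm mu w = 0 <-> vanishes_along_curves w.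
Proof.
split=> [|[Z nZ [wZ wg]]].
  move/eqP; rewrite /Ntilde_norm padde_eq0 ?Linfty_norm_ge0//;
    last exact: weak_upper_gradients_ge0.
  move=> /andP[/eqP w0 /eqP inf0].
  have [Z1 nZ1 wZ1] : exists2 Z, borel_null Z & forall x, ~ Z x -> `|w x| <= 0.
    by apply/Linfty_normP; rewrite w0.
  have [Z2 nZ2 Lw] : exists2 Z, borel_null Z & lipschitz_along_curves Z 1 w.
    have : ereal_inf [set Linfty_norm mu g | g in weak_upper_gradient mu w] < 1.
      by rewrite inf0 lte_fin.
    move=> /ereal_inf_lt[_ [g wg <-]] /ltW.
    exact: weak_upper_gradient_lipschitz.
  have nZ := borel_nullU nZ1 nZ2.
  have wZ x : ~ (Z1 `|` Z2) x -> w x = 0.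
    move=> Zx; apply/eqP; rewrite -abse_eq0 eq_le abse_ge0 andbT.
    by apply: wZ1 => Z1x; apply: Zx; left.
  exists (Z1 `|` Z2) => //; split => // gamma Ug aZ.
  have {}Lw := lipschitz_along_curvesS nZ2.1 nZ.1 (@subsetUr _ _ _) Lw.
  have w_eq0 t : (cstart gamma <= t <= cend gamma)%R -> w (gamma t) = 0.
    move=> tab; rewrite (@eq_along_curve _ _ _ 1 0 w (fun=> 0%R) gamma t nZ.1)//.
    by move=> g _ _; rewrite subee// abse0 mul0e.
  by split; apply: w_eq0; rewrite lexx cstart_le_cend.
have Linf0 : Linfty_norm mu w = 0.
  apply/eqP; rewrite eq_le Linfty_norm_ge0 andbT.
  by apply/Linfty_normP; exists Z => // x /wZ ->; rewrite abse0.
rewrite /Ntilde_norm Linf0 add0e; apply/eqP.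
rewrite eq_le weak_upper_gradients_ge0 andbT.
apply: ereal_inf_le; exists 0 => //; exists (cst 0); last exact: Linfty_norm_cst.
apply: (@lipschitz_weak_upper_gradient _ _ Z) => // gamma Ug aZ.
by have [-> ->] := wg _ Ug aZ; rewrite subee// abse0 mul0e.
Qed.

End WeakUpperGradients.

(** * Pointwise Lipschitz constants *)

Section PointwiseLipschitz.
Context {R : realType} {X : pMetricType R}.
Implicit Types (f h : X -> R) (x y : X) (K L : R).

Lemma Lip_ge0 f x : (0 <= Lip f x)%E.
Proof.
rewrite /Lip; case: asboolP => // xNiso.
apply/ereal_infP => _ [V xV <-].
have [y Vy] : V !=set0.
  apply/set0P/negP => /eqP V0; apply: xNiso; split; first by rewrite inE.
  exists [set x]; last by rewrite setIT.
  move: xV; rewrite V0 => /nbhs_ballP[e e0 eV]; apply/nbhs_ballP; exists e => //.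
  move=> y /eV /= h; apply/eqP/negP => /negP.
  by move=> /h.
apply: (@le_trans _ _ (`|f x - f y| / mdist x y)%:E).
  by rewrite lee_fin divr_ge0// mdist_ge0.
by apply: ereal_sup_ubound; exists y.
Qed.

(** At an isolated point [x] a small ball contains no other point, and the bound
    holds for any [K]. *)
Lemma Lip_lt f x K : (Lip f x < K%:E)%E -> exists2 d, 0 < d &
  forall y, mdist x y < d -> `|f x - f y| <= K * mdist x y.
Proof.
rewrite /Lip; case: asboolP => [[_ [V xV VE]] _|_].
  move: xV => /nbhs_ballP[d d0 dV]; exists d => // y xy.
  have : (V `&` setT) y by split => //; apply: dV; rewrite ballEmdist.
  by rewrite VE => ->; rewrite subrr normr0 mdistxx mulr0.
move=> /ereal_inf_lt[_ [V xV <-]] VK.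
move: xV => /nbhs_ballP[d /= d0 dV]; exists d => // y xy.
have [->|xNy] := eqVneq x y; first by rewrite subrr normr0 mdistxx mulr0.
rewrite -ler_pdivrMr ?mdist_gt0// -lee_fin; apply: le_trans (ltW VK).
apply: ereal_sup_ubound; exists y => //; apply: dV; last by rewrite eq_sym.
by rewrite ballEmdist.
Qed.

Lemma Lip_le f x K : 0 <= K -> (exists2 d, 0 < d &
  forall y, mdist x y < d -> `|f x - f y| <= K * mdist x y) ->
  (Lip f x <= K%:E)%E.
Proof.
move=> K0 [d d0 dK]; rewrite /Lip; case: asboolP => [_|_]; first by rewrite lee_fin.
apply: ereal_inf_le.
exists (ereal_sup [set (`|f x - f y| / mdist x y)%:E
   | y in [set y | y != x /\ mdist x y < d]]).
  exists [set y | y != x /\ mdist x y < d] => //.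
  apply/nbhs_ballP; exists d => // y; rewrite ballEmdist/= => xy yx.
  by split.
apply: ge_ereal_sup => _ [y [yx xy] <-].
by rewrite lee_fin ler_pdivrMr ?mdist_gt0 1?eq_sym// dK.
Qed.

Lemma sup_norm_ge (u : X -> \bar R) x : (`|u x| <= sup_norm u)%E.
Proof. by apply: ereal_sup_ubound; exists x. Qed.

Lemma sup_norm_le (u : X -> \bar R) (M : \bar R) :
  (forall x, `|u x| <= M)%E -> (sup_norm u <= M)%E.
Proof. by move=> uM; apply: ge_ereal_sup => _ [x _ <-]. Qed.

Lemma sup_norm_ge0 (u : X -> \bar R) : (0 <= sup_norm u)%E.
Proof. exact: le_trans (sup_norm_ge u point). Qed.

Lemma continuous_pointwise_lipschitz f :
  (forall x, exists2 d, 0 < d & exists K,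
    forall y, mdist x y < d -> `|f x - f y| <= K * mdist x y) ->
  continuous f.
Proof.
move=> Lf x; apply/cvgrPdist_lt => e e0.
have [d d0 [K dK]] := Lf x.
have K1 : 0 < `|K| + 1 by rewrite ltr_wpDl.
apply/nbhs_ballP; exists (Num.min d (e / (`|K| + 1))).
  by rewrite /= lt_min d0 divr_gt0.
move=> y; rewrite ballEmdist/= lt_min ltr_pdivlMr// => /andP[/dK h xye].
apply: (le_lt_trans h); apply: le_lt_trans xye; rewrite mulrC ler_wpM2l//.
  exact: mdist_ge0.
by rewrite (le_trans (ler_norm _))// lerDl.
Qed.

Lemma Dinfty_pointwise f K x : (sup_norm (Lip f) < K%:E)%E ->
  exists2 d, 0 < d &
    forall y, mdist x y < d -> `|f x - f y| <= K * mdist x y.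
Proof.
move=> fK; apply: Lip_lt; apply: le_lt_trans fK.
by rewrite -[leLHS]gee0_abs ?Lip_ge0//; exact: sup_norm_ge.
Qed.

Lemma Dinfty_fin f : Dinfty X f -> sup_norm (Lip f) \is a fin_num.
Proof. by move=> [_ fL]; rewrite ge0_fin_numE// sup_norm_ge0. Qed.

Lemma Dinfty_continuous f : Dinfty X f -> continuous f.
Proof.
move=> Df; apply: continuous_pointwise_lipschitz => x.
have [|d d0 dP] := @Dinfty_pointwise f (fine (sup_norm (Lip f)) + 1) x.
  by rewrite -[ltLHS](fineK (Dinfty_fin Df)) lte_fin ltrDl.
by exists d => //; exists (fine (sup_norm (Lip f)) + 1).
Qed.

Lemma Dinfty_lipschitz_along_curve f (gamma : curve X) : Dinfty X f ->
  rectifiable gamma ->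
  `|f (gamma (cstart gamma)) - f (gamma (cend gamma))|
    <= fine (sup_norm (Lip f)) * travelled gamma (cend gamma).
Proof.
move=> Df rg; apply/ler_addgt0Pl => e e0.
(* The pointwise estimate is available for the constants greater than [L] only. *)
set L := fine _; set l := travelled _ _.
have l0 : 0 <= l by exact: travelled_end_ge0.
have l1 : 0 < l + 1 by rewrite ltr_wpDl.
have L0 : 0 <= L by rewrite fine_ge0// sup_norm_ge0.
have eL : 0 < e / (l + 1) by rewrite divr_gt0.
have h : (sup_norm (Lip f) < (L + e / (l + 1))%:E)%E.
  by rewrite -[ltLHS](fineK (Dinfty_fin Df)) lte_fin ltrDl.
apply: (le_trans (pointwise_lipschitz_along_curve (L := L + e / (l + 1)) _ _ rg)).
- by rewrite addr_ge0// ltW.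
- by move=> x; exact: Dinfty_pointwise h.
rewrite mulrDl addrC lerD2r -/l mulrAC ler_pdivrMr// ler_wpM2l ?ltW//.
by rewrite ltrDl.
Qed.

Lemma borel_continuous f : continuous f -> borel_fun_on setT (EFin \o f).
Proof.
move=> cf; apply/measurable_EFinP.
apply: (measurability _ (RGenOpens.measurableE R)) => _ [_ [a [b ->] <-]].
rewrite setTI; apply: sub_sigma_algebra.
by move/continuousP : cf; apply; exact: interval_open.
Qed.

End PointwiseLipschitz.

Section ContinuousAlmostEverywhere.
Context {R : realType} {X : pMetricType R}.
Variable mu : {outer_measure set X -> \bar R}.
Hypothesis mu_ball_gt0 : forall (x : X) (r : R), 0 < r -> (0 < mu (ball x r))%E.

(** Balls have positive measure, so that null sets have empty interior. *)
Lemma open_Nnull (Z U : set X) (x : X) : mu Z = 0%E -> nbhs x U -> exists2 y, U y & ~ Z y.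
Proof.
move=> Z0 /nbhs_ballP[r r0 rU]; apply: contrapT => h.
have := mu_ball_gt0 x r0; rewrite ltNge => /negP; apply; rewrite -Z0.
apply: le_outer_measure => y /rU Uy; apply: contrapT => Zy.
by apply: h; exists y.
Qed.

Lemma continuous_ae_closed (T : topologicalType) (f : X -> T) (C : set T) Z :
  continuous f -> closed C -> mu Z = 0%E -> (forall x, ~ Z x -> C (f x)) ->
  forall x, C (f x).
Proof.
move=> cf cC Z0 fC x; apply: cC => B /cf fB.
by have [y By /fC Cy] := open_Nnull Z0 fB; exists (f y).
Qed.

Lemma continuous_ae_le (f : X -> R) (M : R) Z : continuous f -> mu Z = 0%E ->
  (forall x, ~ Z x -> `|f x| <= M) -> forall x : X, `|f x| <= M.
Proof.
move=> cf Z0 fM.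
apply: (@continuous_ae_closed R (fun y => `|f y|) [set r | r <= M] Z) => //.
by move=> y; apply: continuous_comp; [exact: cf|exact: norm_continuous].
Qed.

Lemma continuous_ae_eq (f h : X -> R) Z : continuous f -> continuous h ->
  mu Z = 0%E -> (forall x, ~ Z x -> f x = h x) -> f = h.
Proof.
move=> cf ch Z0 fh; apply/funext => x; apply/eqP; rewrite -subr_eq0 -normr_le0.
apply: (@continuous_ae_le (f \- h) 0 Z) => //.
  by move=> y; apply: cvgB; [exact: cf|exact: ch].
by move=> y /fh /= ->; rewrite subrr normr0.
Qed.

End ContinuousAlmostEverywhere.

(** * Doubling measures *)

Definition doubling_with {R : realType} {X : pMetricType R}
    (mu : {outer_measure set X -> \bar R}) (C : R) :=
  0 < C /\ forall (x : X) (r : R), 0 < r ->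
    [/\ (0 < mu (ball x (2 * r)))%E,
        (mu (ball x (2 * r)) <= C%:E * mu (ball x r))%E &
        (C%:E * mu (ball x r) < +oo)%E].

Section Doubling.
Context {R : realType} {X : pMetricType R}.
Variable mu : {outer_measure set X -> \bar R}.
Variable C : R.
Hypothesis dbl : doubling_with mu C.
Let C_gt0 : 0 < C := dbl.1.
Let mu_doubling := dbl.2.
Hypothesis mu_borel : borel_set `<=` mu.-caratheodory.
Implicit Types (x y z : X) (r : R) (s : seq X) (A B N S : set X).

Definition ball_mass x r := fine (mu (ball x r)).

Lemma mu_ball_gt0 x r : 0 < r -> (0 < mu (ball x r))%E.
Proof.
move=> r0; have [|h _ _] := mu_doubling x (r := r / 2); first by rewrite divr_gt0.
by rewrite (_ : r = 2 * (r / 2))//; field.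
Qed.

Lemma mu_ball_lty x r : 0 < r -> (mu (ball x r) < +oo)%E.
Proof.
move=> r0; have [_ _] := mu_doubling x r0.
by case: (mu (ball x r)) => [? _| |]; rewrite ?ltry ?gt0_muley ?lte_fin// ltxx.
Qed.

Lemma ball_massE x r : 0 < r -> mu (ball x r) = (ball_mass x r)%:E.
Proof. by move=> r0; rewrite fineK// ge0_fin_numE ?mu_ball_lty// ltW// mu_ball_gt0. Qed.

Lemma ball_mass_gt0 x r : 0 < r -> 0 < ball_mass x r.
Proof. by move=> r0; rewrite -lte_fin -ball_massE// mu_ball_gt0. Qed.

Lemma ball_mass_le x y r r' : 0 < r -> 0 < r' -> ball x r `<=` ball y r' ->
  ball_mass x r <= ball_mass y r'.
Proof. by move=> r0 r'0 xy; rewrite -lee_fin -!ball_massE// le_outer_measure. Qed.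

Lemma ball_mass_double x r n : 0 < r ->
  ball_mass x (2 ^+ n * r) <= C ^+ n * ball_mass x r.
Proof.
move=> r0; elim: n => [|n ih]; first by rewrite !expr0 !mul1r.
have r1 : 0 < 2 ^+ n * r by rewrite mulr_gt0// exprn_gt0.
have [_ + _] := mu_doubling x r1.
rewrite !ball_massE ?mulr_gt0// -EFinM lee_fin mulrA -exprS => h.
by rewrite (le_trans h)// exprS -mulrA ler_pM2l.
Qed.

Lemma subset_ball x y r r' : mdist y x + r <= r' -> ball x r `<=` ball y r'.
Proof.
move=> h z; rewrite !ballEmdist/= => xz; apply: lt_le_trans h.
by apply: (le_lt_trans (metric_triangle y x z)); rewrite ltrD2l.
Qed.

Lemma borel_ball x r : borel_set (ball x r).
Proof.
have [r0|r0] := ltP 0 r.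
  apply: sub_sigma_algebra; rewrite ballEmdist openE => y /= xy.
  apply/nbhs_ballP; exists (r - mdist x y); first by rewrite /= subr_gt0.
  move=> z; rewrite ballEmdist/= ltrBrDl => h.
  exact: le_lt_trans (metric_triangle x y z) h.
rewrite (_ : ball x r = set0); first exact: measurable0.
rewrite -subset0 ballEmdist => y /= h.
by have := lt_le_trans h r0; rewrite ltNge mdist_ge0.
Qed.

(** The Caratheodory criterion removes the sets [B x] from [A] one at a time. *)
Lemma sum_mu_disjoint s (B : X -> set X) A :
  (forall x, mu.-caratheodory (B x)) ->
  pairwise (fun x y => `[< B y `<=` ~` B x >]) s ->
  (\sum_(x <- s) mu (A `&` B x) <= mu A)%E.
Proof.
move=> mB; elim: s A => [|x s ih] A /=; first by rewrite big_nil.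
move=> /andP[/allP xs ps]; rewrite big_cons (mB x A) leeD2l//.
apply: le_trans (ih _ ps); rewrite big_seq [leRHS]big_seq; apply: lee_sum => y ys.
rewrite -setIA (_ : ~` B x `&` B y = B y)//.
by apply/setIidPr/asboolP; exact: xs.
Qed.

Definition separated S r s :=
  (forall x, x \in s -> S x) /\ pairwise (fun x y => r <= mdist x y) s.

(** The balls of radius [r / 2] are disjoint and lie in [ball x0 (2 * R0)]. *)
Lemma separated_mass x0 R0 S r s : 0 < r -> r <= R0 -> S `<=` ball x0 R0 ->
  separated S r s ->
  \sum_(x <- s) ball_mass x (r / 2) <= ball_mass x0 (2 * R0).
Proof.
move=> r0 rR SB [sS sr]; have R0_gt0 := lt_le_trans r0 rR.
rewrite -lee_fin -sumEFin -ball_massE ?mulr_gt0//.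
apply: le_trans (@sum_mu_disjoint s (fun x => ball x (r / 2)) _ _ _).
- rewrite big_seq [leRHS]big_seq; apply: lee_sum => x xs.
  rewrite -ball_massE ?divr_gt0// (_ : _ `&` _ = ball x (r / 2))//.
  apply/setIidPr; apply: subset_ball.
  by have := SB _ (sS _ xs); rewrite ballEmdist/=; lra.
- by move=> x; apply: mu_borel; exact: borel_ball.
apply: sub_pairwise sr => x y xy; apply/asboolP => z; rewrite !ballEmdist/= => yz xz.
have := metric_triangle x z y; rewrite (metric_sym z y); lra.
Qed.

(** By doubling, each of the disjoint balls of radius [r / 2] contains a fixed
    proportion of the mass of [ball x0 (2 * R0)]. *)
Lemma separated_size x0 R0 S r : 0 < r -> r <= R0 -> S `<=` ball x0 R0 ->
  exists n : nat, forall s, separated S r s -> (size s <= n)%N.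
Proof.
move=> r0 rR SB; have R0_gt0 := lt_le_trans r0 rR.
pose j := Num.trunc (6 * R0 / r).
(* A ball of radius [3 * R0] around a point of [S] contains [ball x0 (2 * R0)]. *)
have jP : 3 * R0 <= 2 ^+ j.+1 * (r / 2).
  have : 6 * R0 / r < j.+1%:R by rewrite truncnS_gt.
  rewrite ltr_pdivrMr// => h.
  have : (j.+1%:R : R) <= 2 ^+ j.+1 by rewrite -natrX ler_nat ltnW// ltn_expl.
  move=> /(ler_wpM2r (ltW r0)); lra.
exists (Num.trunc (C ^+ j.+1)) => s ss; have [sS _] := ss.
rewrite -ltnS -(@ltr_nat R); apply: le_lt_trans (truncnS_gt _).
have m0 : 0 < ball_mass x0 (2 * R0) by rewrite ball_mass_gt0// mulr_gt0.
rewrite -(ler_pM2r m0).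
have Cj : 0 < C ^+ j.+1 by rewrite exprn_gt0.
apply: (@le_trans _ _ (C ^+ j.+1 * \sum_(x <- s) ball_mass x (r / 2))).
  rewrite mulr_sumr (_ : (size s)%:R * _ = \sum_(x <- s) ball_mass x0 (2 * R0)).
    rewrite big_seq [leRHS]big_seq; apply: ler_sum => x xs.
    apply: le_trans (ball_mass_double x j.+1 _); last by rewrite divr_gt0.
    apply: ball_mass_le; rewrite ?mulr_gt0 ?exprn_gt0 ?divr_gt0//.
    apply: subset_ball; have := SB _ (sS _ xs); rewrite ballEmdist/= metric_sym.
    by move: jP; lra.
  by rewrite big_const_seq count_predT iter_addr addr0 mulr_natl.
by rewrite ler_pM2l//; exact: separated_mass ss.
Qed.

(** A separated sequence of maximal size cannot be extended by an uncovered point. *)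
Lemma maximal_separated x0 R0 S r : 0 < r -> r <= R0 -> S `<=` ball x0 R0 ->
  exists2 s, separated S r s & forall y, S y -> exists2 x, x \in s & ball x r y.
Proof.
move=> r0 rR SB; have [n nP] := separated_size r0 rR SB.
pose P k := `[< exists2 s, separated S r s & size s = k >].
have exP : exists k, P k by exists 0%N; apply/asboolP; exists [::].
have Pn k : P k -> (k <= n)%N by move=> /asboolP[s /nP sn <-].
case: (ex_maxnP exP Pn) => k /asboolP[s ss sk] kmax.
exists s => // y Sy; apply: contrapT => h.
suff /kmax : P k.+1 by rewrite ltnn.
apply/asboolP; exists (y :: s); last by rewrite /= sk.
have [sS sr] := ss; split => [x|].
  by rewrite inE => /predU1P[->//|/sS].
rewrite /= sr andbT; apply/allP => x xs; rewrite leNgt; apply/negP => yx.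
by apply: h; exists x => //; rewrite ballEmdist/= metric_sym.
Qed.

(** The balls of radius [r] around a maximal [r]-separated sequence in [S] cover
    [S], and those of radius [r / 2] are disjoint: the masses of the former add up
    to at most [C] times the mass of [ball x0 (2 * R0)]. *)
Lemma density_mass x0 R0 S N r (eta : R) : 0 < r -> r <= R0 ->
  S `<=` ball x0 R0 -> 0 <= eta ->
  (forall x, S x -> (mu (N `&` ball x r) <= eta%:E * mu (ball x r))%E) ->
  (mu (N `&` S) <= (eta * C * ball_mass x0 (2 * R0))%:E)%E.
Proof.
move=> r0 rR SB eta0 dens; have [s ss cov] := maximal_separated r0 rR SB.
have [sS _] := ss.
apply: (@le_trans _ _ (\sum_(x <- s) mu (N `&` ball x r))%E).
  apply: (@le_trans _ _ (mu (\big[setU/set0]_(x <- s) (N `&` ball x r)))).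
    apply: le_outer_measure => y [Ny /cov[x xs xy]].
    by rewrite -bigcup_seq; exists x.
  elim: s {ss cov sS} => [|x s ih]; first by rewrite !big_nil outer_measure0.
  by rewrite !big_cons (le_trans (outer_measureU2 _ _ _))// leeD2l.
apply: (@le_trans _ _ (\sum_(x <- s) (eta * C * ball_mass x (r / 2))%:E)%E).
  rewrite big_seq [leRHS]big_seq; apply: lee_sum => x xs.
  apply: (le_trans (dens _ (sS _ xs))).
  rewrite ball_massE// -EFinM lee_fin -mulrA ler_wpM2l//.
  have := @ball_mass_double x (r / 2) 1; rewrite divr_gt0// !expr1.
  by rewrite (_ : 2 * (r / 2) = r); [apply|field].
rewrite sumEFin lee_fin -mulr_sumr ler_wpM2l//; last exact: separated_mass ss.
by rewrite mulr_ge0// ltW.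
Qed.

End Doubling.

(** * Sequences with geometrically small increments *)

Section DyadicSequences.
Context {R : realType}.

Definition dyadic (k : nat) : R := 2^-1 ^+ k.

Lemma dyadic_gt0 k : 0 < dyadic k.
Proof. by rewrite exprn_gt0// invr_gt0. Qed.

Lemma dyadicS k : dyadic k = 2 * dyadic k.+1.
Proof. by rewrite /dyadic exprS mulrA divff// mul1r. Qed.

Lemma dyadic_le k n : (k <= n)%N -> dyadic n <= dyadic k.
Proof.
elim: n => [|n ih]; first by rewrite leqn0 => /eqP ->.
rewrite leq_eqVlt => /predU1P[->//|]; rewrite ltnS => /ih.
by have := dyadic_gt0 n.+1; rewrite (dyadicS n); lra.
Qed.

Lemma dyadic_small (e : R) : 0 < e -> exists k, dyadic k < e.
Proof.
move=> e0; pose k := Num.trunc e^-1; exists k.+1.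
have : e^-1 < k.+1%:R by rewrite truncnS_gt.
rewrite /dyadic exprVn -[e in X in _ -> X]invrK => h.
rewrite ltf_pV2 ?posrE ?invr_gt0 ?exprn_gt0//; apply: (lt_le_trans h).
by rewrite -natrX ler_nat ltnW// ltn_expl.
Qed.

Lemma dyadic_between (t : R) : 0 < t -> t < 1 ->
  exists n, dyadic n.+1 <= t < dyadic n.
Proof.
move=> t0 t1; have [k kt] := dyadic_small t0.
have ex : exists k, dyadic k <= t by exists k; exact: ltW.
case: (ex_minnP ex) => -[|n] nt nmin; first by move: nt; rewrite /dyadic expr0 leNgt t1.
exists n; rewrite nt ltNge; apply/negP => /nmin.
by rewrite ltnn.
Qed.

(** The increments from [k] on sum up to at most [2 * E * dyadic k]. *)
Lemma dyadic_limit (a : nat -> R) (E : R) k0 :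
  (forall k, (k0 <= k)%N -> `|a k.+1 - a k| <= E * dyadic k) ->
  forall k, (k0 <= k)%N -> `|a k - limn a| <= 2 * E * dyadic k.
Proof.
move=> aE.
have E0 : 0 <= E.
  have := le_trans (normr_ge0 _) (aE k0 (leqnn _)).
  by rewrite pmulr_lge0// dyadic_gt0.
have step k j : (k0 <= k)%N -> `|a k - a (k + j)%N| <= 2 * E * (dyadic k - dyadic (k + j)).
  move=> kk; elim: j => [|j ih]; first by rewrite addn0 !subrr normr0 mulr0.
  rewrite addnS (le_trans (ler_distD (a (k + j)%N) _ _))//.
  have := aE (k + j)%N (leq_trans kk (leq_addr _ _)).
  rewrite [`|a (k + j).+1 - _|]distrC.
  move: ih; rewrite (dyadicS (k + j)); lra.
have tail k n : (k0 <= k)%N -> (k <= n)%N -> `|a k - a n| <= 2 * E * dyadic k.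
  move=> kk kn; rewrite -(subnKC kn) (le_trans (step _ _ kk))//.
  by rewrite ler_wpM2l ?mulr_ge0// gerBl ltW// dyadic_gt0.
have ca : cvgn a.
  apply: cauchy_cvg; apply: cauchy_exP => e /= e0.
  have e1 : 0 < e / (2 * E + 1) by rewrite divr_gt0// ltr_wpDl// mulr_ge0.
  have [k kP] := dyadic_small e1.
  exists (a (maxn k k0)); exists (maxn k k0) => // n /= kn.
  rewrite /ball/=; apply: (le_lt_trans (tail _ _ (leq_maxr _ _) kn)).
  apply: (@le_lt_trans _ _ (2 * E * dyadic k)).
    by rewrite ler_wpM2l ?mulr_ge0// dyadic_le// leq_maxl.
  move: kP; rewrite ltr_pdivlMr; last by rewrite ltr_wpDl// mulr_ge0.
  by have := dyadic_gt0 k; lra.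
move=> k kk; apply/ler_addgt0Pl => e e0.
have /cvgrPdist_lt/(_ e e0)[n _ nP] := ca.
have := nP (maxn n k) (leq_maxl _ _).
rewrite [`|limn a - _|]distrC.
have := tail k (maxn n k) kk (leq_maxr _ _).
have := ler_distD (a (maxn n k)) (a k) (limn a).
lra.
Qed.

End DyadicSequences.

(** * Means over balls *)

Section Means.
Context {R : realType} {X : pMetricType R}.
Variable mu : {outer_measure set X -> \bar R}.
Hypothesis mu_regular : borel_regular mu.
Variable C : R.
Hypothesis dbl : doubling_with mu C.
Let C_gt0 : 0 < C := dbl.1.
Variables (v : X -> R) (V : R).
Hypotheses (v_borel : borel_fun_on setT (EFin \o v))
  (v_bounded : forall x, `|v x| <= V).
Implicit Types (x y z : X) (r : R).

Let ballE x r : 0 < r -> mu (ball x r) = (ball_mass mu x r)%:E.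
Proof. exact: ball_massE dbl x r. Qed.
Let ball_gt0 x r : 0 < r -> 0 < ball_mass mu x r.
Proof. exact: ball_mass_gt0 dbl x r. Qed.
Let mball x r : measurable (ball x r : set (caratheodory_type mu)) :=
  borel_measurable_cara mu_regular (borel_ball x r).

Definition mean x r : R := fine (average mu (ball x r) (EFin \o v)).

Definition oscillation x r (c : R) : \bar R :=
  (\int[cara mu]_(z in (ball x r : set (caratheodory_type mu))) `|v z - c|%:E)%E.

Let mv : measurable_fun [set: caratheodory_type mu] v.
Proof. by apply/measurable_EFinP; exact: borel_fun_cara v_borel. Qed.

Lemma integrable_ball x r : 0 < r -> (cara mu).-integrable
  (ball x r : set (caratheodory_type mu)) (EFin \o v).
Proof.
move=> r0; apply: measurable_bounded_integrable => //.
- exact: (mu_ball_lty dbl).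
- exact: measurable_funTS.
- exists V; split; first exact: num_real.
  by move=> W /ltW VW z _ /=; exact: le_trans VW.
Qed.

Lemma averageE x r : 0 < r ->
  average mu (ball x r) (EFin \o v) = (mean x r)%:E.
Proof.
move=> r0; rewrite fineK// /average ballE// inver gt_eqF ?ball_gt0//.
by rewrite fin_numM//; exact: integrable_fin_num (integrable_ball x r0).
Qed.

Lemma integral_meanE x r : 0 < r ->
  (\int[cara mu]_(z in (ball x r : set (caratheodory_type mu))) (v z)%:E)%E
  = (mean x r * ball_mass mu x r)%:E.
Proof.
move=> r0; rewrite EFinM -averageE// /average -ballE// muleC muleA.
by rewrite divee ?mul1e// ballE// eqe gt_eqF// ball_gt0.
Qed.

Lemma mean_sub_le x r (c : R) : 0 < r ->
  ((`|mean x r - c| * ball_mass mu x r)%:E <= oscillation x r c)%E.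
Proof.
move=> r0; have mb := ball_gt0 x r0.
have ic : (cara mu).-integrable (ball x r : set (caratheodory_type mu))
    (EFin \o cst c).
  apply: measurable_bounded_integrable => //; first exact: (mu_ball_lty dbl).
  exists `|c|; split; first exact: num_real.
  by move=> W /ltW cW z _.
have -> : ((`|mean x r - c| * ball_mass mu x r)%:E =
    `|\int[cara mu]_(z in (ball x r : set (caratheodory_type mu)))
       ((v z)%:E - (cst c z)%:E)|)%E.
  rewrite integralB_EFin//; last exact: integrable_ball.
  rewrite integral_meanE// (integral_cst (cara mu) (mball x r) c%:E).
  rewrite -[cara mu _]/(mu (ball x r)) ballE//.
  by rewrite -EFinM -EFinB abse_EFin -mulrBl normrM (gtr0_norm mb).
apply: (le_trans (le_abse_integral _ _ _)) => //.
apply: measurable_funTS; apply/measurable_EFinP.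
exact: measurable_funB.
Qed.

Lemma mean_bounded x r : 0 < r -> `|mean x r| <= V.
Proof.
move=> r0; have mb := ball_gt0 x r0.
have := mean_sub_le x 0 r0; rewrite subr0 => h.
rewrite -(ler_pM2r mb) -lee_fin (le_trans h)// EFinM -ballE//.
rewrite -[mu (ball x r)]/(cara mu (ball x r)) -integral_cst//.
apply: ge0_le_integral => //.
- apply/measurable_EFinP; apply: measurableT_comp => //.
  by apply: measurable_funTS; exact: measurable_funB.
- by move=> z _; rewrite subr0 lee_fin.
Qed.

Lemma oscillation_subset x y r r' (c : R) : ball x r `<=` ball y r' ->
  (oscillation x r c <= oscillation y r' c)%E.
Proof.
move=> xy; apply: ge0_subset_integral => //.
apply/measurable_EFinP; apply: measurableT_comp => //.
by apply: measurable_funTS; exact: measurable_funB.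
Qed.

Lemma chebyshev_ball x r (c e : R) : 0 < e ->
  (e%:E * mu ([set z | (e <= `|v z - c|)%R] `&` ball x r)
    <= oscillation x r c)%E.
Proof.
move=> e0; have := @le_integral_abse _ _ _ (cara mu) (ball x r) (mball x r)
  (fun z => (v z - c)%:E) e.
rewrite setIC; apply => //; apply/measurable_EFinP.
by apply: measurable_funTS; exact: measurable_funB.
Qed.

End Means.

(** * The representative given by the Poincare inequality *)

Section Poincare.
Context {R : realType} {X : pMetricType R}.
Variable mu : {outer_measure set X -> \bar R}.
Hypothesis mu_regular : borel_regular mu.
Variable C : R.
Hypothesis dbl : doubling_with mu C.
Let C_gt0 : 0 < C := dbl.1.
Variables (p Cp : R).
Hypotheses (p_ge1 : 1 <= p) (Cp_gt0 : 0 < Cp)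
  (poincare : local_weak_poincare mu p Cp).
Variables (v : X -> R) (V M : R) (Z : set X).
Hypotheses (v_borel : borel_fun_on setT (EFin \o v))
  (v_bounded : forall x, `|v x| <= V) (M_ge0 : 0 <= M)
  (Z_null : borel_null mu Z)
  (v_lipschitz : lipschitz_along_curves Z M (EFin \o v)).
Implicit Types (x y z : X) (r : R).

Notation mean := (mean mu v).
Notation oscillation := (oscillation mu v).

(** The curves that avoid [Z] are taken care of by the value [M], the others by
    the value [+oo] on [Z]. *)
Lemma penalty_upper_gradient A : upper_gradient_in A (EFin \o v) (penalty Z M).
Proof.
have mZ := Z_null.1.
have m0 x : (0 <= penalty Z M x)%E by exact: penalty_ge0.
split; [exact: borel_penalty|by []|].
move=> gamma rg _; rewrite /ug_inequality.
have [nc|cc] := pselect (nonconstant gamma).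
  have [aZ|aZ] := pselect (avoids Z gamma).
    apply: (le_trans (v_lipschitz _ aZ)) => //.
    apply: line_integral_ge => //; first exact: borel_penalty.
    by move=> x; apply: penalty_ge.
  rewrite (line_integral_Navoids rg mZ aZ) ?leey//.
    exact: borel_penalty.
  by move=> x; exact: penalty_in.
have -> : gamma (cend gamma) = gamma (cstart gamma).
  apply/eqP; rewrite eq_sym; apply: contrapT => /negP h; apply: cc.
  exists (cstart gamma), (cend gamma).
  by rewrite !in_itv/= !lexx cstart_le_cend; split.
by rewrite /= subrr normr0; apply: integral_ge0.
Qed.

Lemma average_penalty x r : 0 < r ->
  ((average mu (ball x r) (fun z => penalty Z M z `^ p)) `^ p^-1 = M%:E)%E.
Proof.
move=> r0; have p0 : p != 0 by rewrite gt_eqF// (lt_le_trans ltr01).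
have mb := ball_mass_gt0 dbl x r0.
rewrite /average (@ge0_ae_eq_integral _ _ _ _ _ _ (cst (M `^ p)%:E)) //.
- rewrite integral_cst; last exact: (borel_measurable_cara mu_regular (borel_ball x r)).
  rewrite -[X in (_ * (_ * X))%E]/(mu (ball x r)) (ball_massE dbl)//.
  rewrite inver gt_eqF//.
  rewrite -!EFinM mulrCA mulVf ?gt_eqF// mulr1 -poweR_EFin -poweRrM mulfV//.
  by rewrite poweRe1// lee_fin.
- exact: (borel_measurable_cara mu_regular (borel_ball x r)).
- apply: measurable_funTS.
  apply: (@measurableT_comp _ _ _ _ _ _ (fun y : \bar R => (y `^ p)%E)).
    exact: measurable_poweR.
  by apply: borel_fun_cara => //; apply: borel_penalty; case: Z_null.
- by move=> z _; exact: poweR_ge0.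
- by move=> z _; rewrite lee_fin powR_ge0.
apply/aeP => //; exists Z => // z Zz _ /=.
by rewrite penalty_out.
Qed.

(** The Poincare inequality for [v], after evaluation of its right-hand side, at
    all small scales near [x]. The dilation factor is gone, as the average of
    [penalty Z M `^ p] is the same on all balls. *)
Definition regular_near x (rho : R) := forall y r, mdist x y < rho ->
  0 < r -> r <= rho ->
  (oscillation y r (mean y r) <= (Cp * M * r * ball_mass mu y r)%:E)%E.

Lemma regular_nearP x : exists2 rho, 0 < rho & regular_near x rho.
Proof.
have [U [lam [/nbhs_ballP[t /= t0 tU] lam1 HP]]] := poincare x.
have lam0 : 0 < lam by rewrite (lt_le_trans ltr01).
(* [t / 2] is reserved for the distance of the centres and [t / 2] for the dilated
   radius. *)
exists (t / (2 * lam)) => [|y r xy r0 rt]; first by rewrite divr_gt0// mulr_gt0.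
have lr0 : 0 < lam * r by rewrite mulr_gt0.
have BU : ball y (lam * r) `<=` U.
  apply: subset_trans tU; apply: subset_ball.
  have h1 : lam * r <= t / 2.
    move: rt; rewrite ler_pdivlMr ?mulr_gt0//; lra.
  have h2 : t / (2 * lam) <= t / 2.
    by rewrite ler_pM2l// lef_pV2 ?posrE ?mulr_gt0// ler_peMr.
  lra.
have := HP y r (EFin \o v) (penalty Z M) r0 BU
  (integrable_ball mu_regular dbl v_borel v_bounded _ lr0)
  (penalty_upper_gradient _).
rewrite average_penalty// (averageE mu_regular dbl v_borel v_bounded)//.
rewrite /average (ball_massE dbl)// inver gt_eqF; last first.
  exact: (ball_mass_gt0 dbl).
move=> h.
have mb := ball_mass_gt0 dbl y r0.
rewrite (_ : Cp * M * r * _ = ball_mass mu y r * (Cp * r * M)); last by ring.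
by rewrite EFinM -lee_pdivrMl// EFinM.
Qed.

(** On a ball of comparable mass, the mean oscillation around the mean over the
    larger ball is at most [D] times the one on the larger ball. *)
Lemma regular_near_mean x rho y z r s (D : R) : regular_near x rho ->
  mdist x y < rho -> 0 < r -> 0 < s -> s <= rho ->
  ball z r `<=` ball y s -> ball_mass mu y s <= D * ball_mass mu z r ->
  `|mean z r - mean y s| <= D * Cp * M * s.
Proof.
move=> reg xy r0 s0 srho zy D_mass.
have mb := ball_mass_gt0 dbl z r0.
rewrite -(ler_pM2r mb) -lee_fin.
apply: (le_trans (mean_sub_le mu_regular dbl v_borel v_bounded _ _ r0)).
apply: (le_trans (oscillation_subset mu_regular v_borel _ zy)).
apply: (le_trans (reg _ _ xy s0 srho)); rewrite lee_fin.
rewrite (_ : D * Cp * M * s * _ = Cp * M * s * (D * ball_mass mu z r)); last by ring.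
by rewrite ler_wpM2l// !mulr_ge0// ltW.
Qed.

Definition mean_limit x : R := limn (fun k => mean x (dyadic k)).

Lemma mean_limit_close x rho y k : regular_near x rho -> mdist x y < rho ->
  dyadic k <= rho ->
  `|mean y (dyadic k) - mean_limit y| <= 2 * (C * Cp * M) * dyadic k.
Proof.
move=> reg xy krho.
apply: (@dyadic_limit _ (fun k => mean y (dyadic k)) (C * Cp * M) k) => // n kn.
apply: (regular_near_mean reg xy); rewrite ?dyadic_gt0//.
- exact: le_trans (dyadic_le kn) krho.
- apply: subset_ball; rewrite mdistxx add0r (dyadicS n).
  by have := @dyadic_gt0 R n.+1; lra.
rewrite (dyadicS n); have := ball_mass_double dbl y 1 (dyadic_gt0 n.+1).
by rewrite !expr1.
Qed.

(** In the proof of [mean_limit_lipschitz], [4] is the ratio between the radius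
    used and the distance of the points, [3 * C] comes from the two sums of
    increments and [C ^+ 2] from the comparison of balls around different points. *)
Definition lipschitz_constant : R := 4 * (3 * C + C ^+ 2) * Cp.

(** At a scale comparable to the distance of [x] and [z], both limits are close to
    means over balls, one of which contains the other. *)
Lemma mean_limit_lipschitz x rho z : regular_near x rho ->
  mdist x z < rho / 4 -> mdist x z < 2^-1 ->
  `|mean_limit x - mean_limit z| <= lipschitz_constant * M * mdist x z.
Proof.
move=> reg xz4 xz2; have [<-|xNz] := eqVneq x z.
  by rewrite mdistxx mulr0 subrr normr0.
have d0 : 0 < mdist x z by rewrite mdist_gt0.
(* [dyadic n.+1] exceeds the distance, so that the ball of this radius around [z]
   lies in the ball of radius [dyadic n] around [x]. *)
have [||n /andP[nd dn]] := @dyadic_between _ (2 * mdist x z).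
- by rewrite mulr_gt0.
- lra.
have nrho : dyadic n <= rho by rewrite (dyadicS n); lra.
have n1rho : dyadic n.+1 <= rho by have := @dyadic_gt0 R n; rewrite (dyadicS n); lra.
have dn1 : mdist x z < dyadic n.+1 by move: dn; rewrite (dyadicS n); lra.
have ball1 : mdist x z + dyadic n.+1 <= dyadic n by rewrite (dyadicS n); lra.
have ball2 : mdist z x + dyadic n <= 2 ^+ 2 * dyadic n.+1.
  by rewrite metric_sym (dyadicS n) expr2; lra.
have n4 : dyadic n <= 4 * mdist x z by rewrite (dyadicS n); lra.
have xx : mdist x x < rho by rewrite mdistxx; lra.
have xz : mdist x z < rho by lra.
have h1 := mean_limit_close reg xx nrho.
have h2 := mean_limit_close reg xz n1rho.
have h3 : `|mean z (dyadic n.+1) - mean x (dyadic n)|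
    <= C ^+ 2 * Cp * M * dyadic n.
  apply: (regular_near_mean reg xx); rewrite ?dyadic_gt0//.
    exact: subset_ball.
  apply: le_trans (ball_mass_double dbl z 2 (dyadic_gt0 n.+1)).
  apply: (ball_mass_le dbl); rewrite ?mulr_gt0 ?exprn_gt0 ?dyadic_gt0//.
  exact: subset_ball.
have h4 := ler_distD (mean x (dyadic n)) (mean_limit x) (mean_limit z).
have h5 := ler_distD (mean z (dyadic n.+1)) (mean x (dyadic n)) (mean_limit z).
have -> : lipschitz_constant * M * mdist x z =
  (3 * (C * Cp * M) + C ^+ 2 * Cp * M) * (4 * mdist x z).
  by rewrite /lipschitz_constant; ring.
have CM : 0 <= C * Cp * M by rewrite !mulr_ge0// ltW.
have CM2 : 0 <= C ^+ 2 * Cp * M by rewrite !mulr_ge0// ?exprn_ge0// ltW.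
apply: (@le_trans _ _ ((3 * (C * Cp * M) + C ^+ 2 * Cp * M) * dyadic n)); last first.
  by apply: ler_wpM2l => //; rewrite addr_ge0// mulr_ge0.
rewrite distrC in h1; rewrite [`|mean z _ - mean x _|]distrC in h3.
have e2 : 2 * (C * Cp * M) * dyadic n.+1 = C * Cp * M * dyadic n.
  by rewrite (dyadicS n); ring.
rewrite e2 in h2; apply: (le_trans h4).
rewrite mulrDl (_ : 3 * (C * Cp * M) * dyadic n =
  2 * (C * Cp * M) * dyadic n + C * Cp * M * dyadic n); last by ring.
rewrite -addrA lerD//; apply: (le_trans h5).
by rewrite addrC lerD.
Qed.

Lemma mean_limit_bounded x : `|mean_limit x| <= V.
Proof.
have [rho rho0 reg] := regular_nearP x.
have xx : mdist x x < rho by rewrite mdistxx.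
apply/ler_addgt0Pl => e e0.
have E1 : 0 < 2 * (C * Cp * M) + 1.
  by rewrite ltr_wpDl// !mulr_ge0// ltW.
have [|k] := @dyadic_small _ (Num.min rho (e / (2 * (C * Cp * M) + 1))).
  by rewrite lt_min rho0 divr_gt0.
rewrite lt_min ltr_pdivlMr// => /andP[krho ke].
have := mean_limit_close reg xx (ltW krho).
have := mean_bounded mu_regular dbl v_borel v_bounded x (dyadic_gt0 k).
have := ler_normB (mean x (dyadic k)) (mean x (dyadic k) - mean_limit x).
rewrite subKr; have := @dyadic_gt0 R k; move: ke.
lra.
Qed.


Definition mean_limit_gap (e : R) : set X :=
  [set z | e <= `|v z - mean_limit z|].

(** On a ball of radius [r] the limit differs from the mean of [v] by [O(r)],
    hence by at most [e / 2] for small [r], and [v] differs from that mean by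
    less than [e / 2] off a set of density [O(r)], by Chebyshev's inequality. *)
Lemma mean_limit_gap_density m k x (e : R) : 0 < e ->
  regular_near x (dyadic m) -> (m.+2 <= k)%N ->
  (2 * (C * Cp * M) + lipschitz_constant * M) * dyadic k <= e / 2 ->
  (mu (mean_limit_gap e `&` ball x (dyadic k))
    <= (2 / e * (Cp * M * dyadic k))%:E * mu (ball x (dyadic k)))%E.
Proof.
move=> e0 reg mk kE.
have k2 : dyadic k <= dyadic m.+2 :> R by exact: dyadic_le.
have m24 : dyadic m.+2 = dyadic m / 4 :> R.
  by rewrite (dyadicS m) (dyadicS m.+1); field.
have m22 : dyadic m.+2 <= 2^-1 :> R := @dyadic_le R 1 m.+2 isT.
have k0 := @dyadic_gt0 R k.
have m0 := @dyadic_gt0 R m.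
have km : dyadic k <= dyadic m :> R by lra.
have xx : mdist x x < dyadic m by rewrite mdistxx.
have gapS : mean_limit_gap e `&` ball x (dyadic k) `<=`
    [set z | e / 2 <= `|v z - mean x (dyadic k)|] `&` ball x (dyadic k).
  move=> z [/= ez xz]; split => //=.
  have xzk : mdist x z < dyadic k by move: xz; rewrite ballEmdist.
  have h1 := mean_limit_close reg xx km.
  have h2 : `|mean_limit x - mean_limit z| <= lipschitz_constant * M * dyadic k.
    apply: le_trans (mean_limit_lipschitz reg _ _) _; [lra|lra|].
    apply: ler_wpM2l (ltW xzk); rewrite /lipschitz_constant.
    by rewrite !mulr_ge0// ?addr_ge0 ?mulr_ge0 ?exprn_ge0// ltW.
  have h3 := ler_distD (mean x (dyadic k)) (v z) (mean_limit z).
  have h4 := ler_distD (mean_limit x) (mean x (dyadic k)) (mean_limit z).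
  have h5 : `|mean x (dyadic k) - mean_limit z| <= e / 2.
    by rewrite (le_trans h4)// (le_trans _ kE)// mulrDl lerD.
  by rewrite -(lerD2r (e / 2)) -splitr (le_trans ez)// (le_trans h3)// lerD2l.
apply: (le_trans (le_outer_measure mu _ _ gapS)).
have e20 : 0 < e / 2 by rewrite divr_gt0.
have h := chebyshev_ball mu_regular v_borel x (dyadic k) (mean x (dyadic k)) e20.
have := le_trans h (reg x (dyadic k) xx k0 km).
rewrite -lee_pdivlMl// => /le_trans; apply.
rewrite (ball_massE dbl)// -!EFinM lee_fin le_eqVlt; apply/orP; left; apply/eqP.
by field; rewrite gt_eqF.
Qed.

(** The scale [dyadic k] is arbitrary in [mean_limit_gap_density], and
    [density_mass] turns small density into small mass, for outer measures since
    the set of the regular points need not be measurable. *)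
Lemma mean_limit_gap_null m n (e : R) : 0 < e ->
  mu (mean_limit_gap e `&` [set x | regular_near x (dyadic m) /\
    ball point n.+1%:R x]) = 0%E.
Proof.
move=> e0; apply/eqP; rewrite eq_le outer_measure_ge0 andbT.
apply/lee_addgt0Pr => t t0; rewrite add0e.
pose m0 := ball_mass mu point (2 * n.+1%:R).
have m00 : 0 < m0 by apply: (ball_mass_gt0 dbl); rewrite mulr_gt0.
pose W := 2 / e * (Cp * M) * C * m0.
have W0 : 0 <= W by rewrite /W !mulr_ge0// ?invr_ge0 ltW.
pose E := 2 * (C * Cp * M) + lipschitz_constant * M.
have E0 : 0 <= E.
  rewrite /E /lipschitz_constant addr_ge0 ?mulr_ge0// ?addr_ge0 ?mulr_ge0//;
  by rewrite ?exprn_ge0// ltW.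
have E1 : 0 < E + 1 by rewrite ltr_wpDl.
have W1 : 0 < W + 1 by rewrite ltr_wpDl.
have [|k1] := @dyadic_small _ (Num.min (e / 2 / (E + 1)) (t / (W + 1))).
  by rewrite lt_min !divr_gt0.
rewrite lt_min => /andP[k1E k1W].
pose k := maxn k1 m.+2.
have k0 := @dyadic_gt0 R k.
have kk1 : dyadic k <= dyadic k1 :> R by rewrite dyadic_le// leq_maxl.
have kE : E * dyadic k <= e / 2.
  have := le_lt_trans kk1 k1E; rewrite ltr_pdivlMr// mulrDr mulr1 mulrC => h.
  by apply/ltW/(lt_trans _ h); rewrite ltrDl.
have kW : W * dyadic k <= t.
  have := le_lt_trans kk1 k1W; rewrite ltr_pdivlMr// mulrDr mulr1 mulrC => h.
  by apply/ltW/(lt_trans _ h); rewrite ltrDl.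
have kn : dyadic k <= n.+1%:R :> R.
  apply: (@le_trans _ _ (dyadic 0)); first exact: dyadic_le.
  by rewrite /dyadic expr0 ler1n.
apply: (le_trans (density_mass dbl mu_regular.1 k0 kn _
  (x0 := point) (eta := 2 / e * (Cp * M * dyadic k)) _ _)).
- by move=> x [].
- by rewrite !mulr_ge0// ?invr_ge0 ltW.
- move=> x [reg _]; apply: (mean_limit_gap_density e0 reg) => //.
  exact: leq_maxr.
rewrite lee_fin; apply: le_trans kW; rewrite /W -/m0 le_eqVlt; apply/orP; left.
by apply/eqP; ring.
Qed.

Lemma regular_nearW x rho rho' : rho' <= rho -> regular_near x rho ->
  regular_near x rho'.
Proof.
move=> h reg y r xy r0 rr; apply: reg => //; first exact: lt_le_trans h.
exact: le_trans h.
Qed.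

Lemma mean_limit_ae :
  exists2 N, borel_null mu N & forall x, ~ N x -> mean_limit x = v x.
Proof.
pose F (j m n : nat) := mean_limit_gap j.+1%:R^-1 `&`
  [set x | regular_near x (dyadic m) /\ ball point n.+1%:R x].
have /choice[B BP] (a : nat * nat * nat) :
    exists B, borel_null mu B /\ F a.1.1 a.1.2 a.2 `<=` B.
  have [B [mB FB muB]] := mu_regular.2 (F a.1.1 a.1.2 a.2).
  exists B; split => //; split => //.
  by rewrite -muB mean_limit_gap_null// invr_gt0.
pose N := \bigcup_k (if unpickle k is Some a then B a else set0).
exists N => [|x Nx].
  apply: borel_null_bigcup => k; case: unpickle => [a|]; first by case: (BP a).
  exact: borel_null0.
apply/eqP; rewrite eq_sym -subr_eq0 -normr_eq0; apply/negPn/negP => h0.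
have h : 0 < `|v x - mean_limit x| by rewrite lt_neqAle eq_sym h0 normr_ge0.
apply: Nx.
have [rho rho0 reg] := regular_nearP x.
have [m mrho] := dyadic_small rho0.
pose j := Num.trunc (`|v x - mean_limit x|)^-1.
pose n := Num.trunc (mdist point x).
exists (pickle (j, m, n)) => //; rewrite pickleK.
apply: (BP (j, m, n)).2; split => /=.
  rewrite /mean_limit_gap /= -[leRHS]invrK lef_pV2 ?posrE ?invr_gt0//.
  by rewrite ltW// truncnS_gt.
split; first exact: regular_nearW (ltW mrho) reg.
by rewrite ballEmdist/= truncnS_gt.
Qed.

End Poincare.

(** * Truncation *)

Section Clip.
Context {R : realType}.

(** Composition with [clip V] makes functions bounded without increasing their
    oscillation. *)
Definition clip (V t : R) : R := Num.max (- V) (Num.min V t).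

Lemma clip_bounded V t : 0 <= V -> `|clip V t| <= V.
Proof.
move=> V0; rewrite /clip ler_norml le_max lexx/= ge_max ge_min lexx andbT.
by rewrite ge0_cp.
Qed.

Lemma clip_id V t : `|t| <= V -> clip V t = t.
Proof. by rewrite ler_norml /clip => /andP[h1 /min_r ->]; rewrite max_r. Qed.

Lemma max_lipschitz (a s t : R) : `|Num.max a s - Num.max a t| <= `|s - t|.
Proof.
have h1 := ler_norm (s - t); have h2 := ler_norm (t - s).
rewrite distrC in h2; rewrite ler_norml; apply/andP.
by case: (leP a s) => ?; case: (leP a t) => ?; split; lra.
Qed.

Lemma clip_lipschitz V s t : `|clip V s - clip V t| <= `|s - t|.
Proof.
have minE x : Num.min V x = - Num.max (- V) (- x) by rewrite oppr_max !opprK.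
apply: (le_trans (max_lipschitz _ _ _)); rewrite !minE opprK addrC.
by apply: (le_trans (max_lipschitz _ _ _)); rewrite opprK addrC.
Qed.

Lemma measurable_clip V : measurable_fun [set: R] (clip V).
Proof. by apply: measurable_maxr => //; exact: measurable_minr. Qed.

End Clip.

(** * Classes of functions of bounded pointwise Lipschitz constant *)

Section Representatives.
Context {R : realType} {X : pMetricType R}.
Variable mu : {outer_measure set X -> \bar R}.
Hypotheses (mu_regular : borel_regular mu) (mu_nontrivial : (0 < mu setT)%E).
Implicit Types (u w : X -> \bar R) (f h : X -> R).

Lemma bounded_fun_le f (V : R) : (forall x, `|f x| <= V) -> bounded_fun f.
Proof.
move=> fV; exists V; split; first exact: num_real.
by move=> W /ltW VW x _ /=; exact: le_trans VW.
Qed.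

Lemma Dinfty_lipschitz_along_curves f Z : Dinfty X f ->
  lipschitz_along_curves Z (fine (sup_norm (Lip f))) (EFin \o f).
Proof.
move=> Df gamma [rg _] _; rewrite clengthE// -EFinM lee_fin.
exact: Dinfty_lipschitz_along_curve.
Qed.

Lemma sup_norm_fin f : Dinfty X f -> sup_norm (EFin \o f) \is a fin_num.
Proof.
move=> [[V [_ fV]] _]; rewrite ge0_fin_numE ?sup_norm_ge0//.
apply: (@le_lt_trans _ _ (V + 1)%:E); last exact: ltry.
by apply: sup_norm_le => x; rewrite lee_fin; apply: fV => //; rewrite ltrDl.
Qed.

Lemma fine_Lip_ge0 f : 0 <= fine (sup_norm (Lip f)).
Proof. by rewrite fine_ge0// sup_norm_ge0. Qed.

Lemma Dinfty_weak_upper_gradient f : Dinfty X f ->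
  weak_upper_gradient mu (EFin \o f) (cst (fine (sup_norm (Lip f)))%:E).
Proof.
move=> Df; apply: (lipschitz_weak_upper_gradient mu_regular mu_nontrivial
  (fine_Lip_ge0 f) (borel_null0 mu)).
exact: Dinfty_lipschitz_along_curves.
Qed.

Lemma Linfty_sup_norm f : (Linfty_norm mu (EFin \o f) <= sup_norm (EFin \o f))%E.
Proof.
apply/Linfty_normP => //; exists set0; first exact: borel_null0.
by move=> x _; exact: sup_norm_ge (EFin \o f) x.
Qed.

Lemma Dinfty_Ntilde f : Dinfty X f -> Ntilde mu (EFin \o f).
Proof.
move=> Df; split.
- exact: borel_continuous (Dinfty_continuous Df).
- apply: le_lt_trans (Linfty_sup_norm f) _.
  by rewrite -ge0_fin_numE ?sup_norm_ge0// sup_norm_fin.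
exists (cst (fine (sup_norm (Lip f)))%:E); first exact: Dinfty_weak_upper_gradient.
by rewrite Linfty_norm_cst ?fine_Lip_ge0// ltry.
Qed.

Lemma Ntilde_norm_le f : Dinfty X f ->
  (Ntilde_norm mu (EFin \o f) <= 2%:E * Dinfty_norm f)%E.
Proof.
move=> Df; rewrite (_ : 2%:E = 1 + 1)%E; last by rewrite -EFinD.
have D0 : (0 <= Dinfty_norm f)%E by rewrite le_max sup_norm_ge0.
rewrite ge0_muleDl// !mul1e leeD//.
  by apply: le_trans (Linfty_sup_norm f) _; rewrite le_max lexx.
apply: (@le_trans _ _ (sup_norm (Lip f))); last by rewrite le_max lexx orbT.
apply: ereal_inf_le; exists (sup_norm (Lip f)) => //.
exists (cst (fine (sup_norm (Lip f)))%:E); first exact: Dinfty_weak_upper_gradient.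
by rewrite Linfty_norm_cst ?fine_Lip_ge0// fineK// Dinfty_fin.
Qed.

Lemma sub_EFin_eq0 (a : \bar R) (r : R) : (a - r%:E = 0)%E -> a = r%:E.
Proof.
by case: a => [a| |]//= /eqP; rewrite -EFinB eqe subr_eq0 => /eqP ->.
Qed.

(** Where [u - f] vanishes [u] is finite, so that the infinite values of [w] do not
    matter. *)
Lemma vanishes_sub_trans u f w :
  vanishes_along_curves mu (u \- (EFin \o f))%E ->
  vanishes_along_curves mu (u \- w)%E <->
  vanishes_along_curves mu (EFin \o f \- w)%E.
Proof.
move=> [Z1 nZ1 [uf1 uf2]]; split=> -[Z2 nZ2 [h1 h2]];
  have nZ := borel_nullU nZ1 nZ2; exists (Z1 `|` Z2) => //;
  split => [x Zx|gamma Ug aZ].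
1,3: have /uf1/sub_EFin_eq0 /= e : ~ Z1 x by move=> Z1x; apply: Zx; left.
1,2: by have /h1 /= : ~ Z2 x; [move=> Z2x; apply: Zx; right|rewrite e].
all: have [rg _] := Ug.
all: have /(uf2 _ Ug)[/sub_EFin_eq0 us /sub_EFin_eq0 ue] : avoids Z1 gamma.
1,3: by apply: (avoidsS rg nZ1.1 nZ.1) aZ => x; left.
all: have /(h2 _ Ug) : avoids Z2 gamma.
1,3: by apply: (avoidsS rg nZ2.1 nZ.1) aZ => x; right.
all: by rewrite /= us ue.
Qed.

Lemma N1infty_classP u w : N1infty_class mu u w <->
  Ntilde mu w /\ vanishes_along_curves mu (u \- w)%E.
Proof.
split=> -[Nw h]; split => //; first exact/Ntilde_norm_eq0.
exact/(Ntilde_norm_eq0 mu_regular mu_nontrivial).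
Qed.

Lemma mem_N1infty_class f : Dinfty X f -> N1infty_class mu (EFin \o f) (EFin \o f).
Proof.
move=> Df; apply/N1infty_classP; split; first exact: Dinfty_Ntilde.
exists set0; first exact: borel_null0.
by split=> [x _|gamma _ _]; rewrite /= -!EFinB !subrr.
Qed.

(** By [eq_along_curve], [u] and [f] agree at the end points of almost every curve
    as well. *)
Lemma N1infty_class_eq u f Z : borel_null mu Z ->
  (forall x, ~ Z x -> u x = (f x)%:E) -> Dinfty X f -> Ntilde mu u ->
  N1infty_class mu u = N1infty_class mu (EFin \o f).
Proof.
move=> nZ uf Df [_ _ [g wg]] gy.
have M0 : 0 <= fine (Linfty_norm mu g) by rewrite fine_ge0// Linfty_norm_ge0.
have gM : (Linfty_norm mu g <= (fine (Linfty_norm mu g))%:E)%E.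
  by rewrite fineK// ge0_fin_numE// Linfty_norm_ge0.
have [Z1 nZ1 Lu] := weak_upper_gradient_lipschitz mu_regular mu_nontrivial M0 wg gM.
have nZZ := borel_nullU nZ nZ1.
have uf' x : ~ (Z `|` Z1) x -> u x = (f x)%:E.
  by move=> Zx; apply: uf => Zx'; apply: Zx; left.
have vuf : vanishes_along_curves mu (u \- (EFin \o f))%E.
  exists (Z `|` Z1) => //; split=> [x /uf' /= ->|gamma Ug aZ].
    by rewrite -EFinB subrr.
  have Lu' := lipschitz_along_curvesS nZ1.1 nZZ.1 (@subsetUr _ _ _) Lu.
  have eqt t : cstart gamma <= t <= cend gamma ->
      (u \- (EFin \o f))%E (gamma t) = 0%E.
    move=> tab; rewrite /= (eq_along_curve nZZ.1 uf' Lu'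
      (Dinfty_lipschitz_along_curves Df) M0 (fine_Lip_ge0 f) Ug aZ tab).
    by rewrite -EFinB subrr.
  by split; apply: eqt; rewrite lexx cstart_le_cend.
apply/seteqP; split => w /N1infty_classP[Nw h]; apply/N1infty_classP;
  by split => //; move: h; apply (vanishes_sub_trans w vuf).
Qed.

End Representatives.

(** * Equivalence of the norms *)

Section PoincareRepresentative.
Context {R : realType} {X : pMetricType R}.
Variable mu : {outer_measure set X -> \bar R}.
Hypotheses (mu_regular : borel_regular mu) (mu_nontrivial : (0 < mu setT)%E).
Variable C : R.
Hypothesis dbl : doubling_with mu C.
Variables (p Cp : R).
Hypotheses (p_ge1 : 1 <= p) (Cp_gt0 : 0 < Cp)
  (poincare : local_weak_poincare mu p Cp).
Implicit Types (u g w : X -> \bar R) (f : X -> R) (M V : R).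
Let K := lipschitz_constant C Cp.

Let C_gt0 : 0 < C := dbl.1.

Lemma lipschitz_constant_gt0 : 0 < K.
Proof. by rewrite /K /lipschitz_constant !mulr_gt0// addr_gt0 ?mulr_gt0 ?exprn_gt0. Qed.

(** The limits of the means of a truncation of [u], which is real-valued even
    where [u] is infinite. *)
Lemma Ntilde_representative u g M V : borel_fun_on setT u -> 0 <= M -> 0 <= V ->
  weak_upper_gradient mu u g -> (Linfty_norm mu g <= M%:E)%E ->
  (Linfty_norm mu u <= V%:E)%E ->
  exists f N, [/\ forall x, `|f x| <= V, forall x, (Lip f x <= (K * M)%:E)%E,
    borel_null mu N & forall x, ~ N x -> u x = (f x)%:E].
Proof.
move=> mu_ M0 V0 wg gM uV.
have [Z nZ Lu] := weak_upper_gradient_lipschitz mu_regular mu_nontrivial M0 wg gM.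
have [Z' nZ' uZ'] := (Linfty_normP mu_regular mu_nontrivial _ _).1 uV.
pose v x := clip V (fine (u x)).
have vV x : `|v x| <= V by exact: clip_bounded.
have mv : borel_fun_on setT (EFin \o v).
  apply/measurable_EFinP; apply: (measurableT_comp (@measurable_clip R V)).
  exact: (measurableT_comp _ mu_).
have Lv : lipschitz_along_curves Z M (EFin \o v).
  move=> gamma Ug aZ; have := Lu _ Ug aZ; rewrite /v /= clengthE; last by case: Ug.
  case: (u _) => [s| |]; case: (u _) => [t| |]//=; rewrite !lee_fin => h.
  exact: le_trans (clip_lipschitz _ _ _) h.
have [N nN fN] := mean_limit_ae mu_regular dbl p_ge1 Cp_gt0 poincare mv vV M0 nZ Lv.
exists (mean_limit mu v), (N `|` Z'); split.
- exact: (mean_limit_bounded mu_regular dbl p_ge1 Cp_gt0 poincare mv vV M0 nZ Lv).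
- move=> x; apply: Lip_le.
    by rewrite mulr_ge0// ltW// lipschitz_constant_gt0.
  have [rho rho0 reg] := regular_nearP mu_regular dbl p_ge1 poincare mv vV M0 nZ Lv x.
  exists (Num.min (rho / 4) 2^-1); first by rewrite lt_min divr_gt0/= ?invr_gt0.
  move=> y; rewrite lt_min => /andP[xy1 xy2].
  exact: (mean_limit_lipschitz mu_regular dbl Cp_gt0 mv vV M0 reg).
- exact: borel_nullU.
move=> x NZ'; rewrite fN; last by move=> Nx; apply: NZ'; left.
have : (`|u x| <= V%:E)%E by apply: uZ' => Zx; apply: NZ'; right.
rewrite /v; case: (u x) => [r| |]//=; rewrite lee_fin => rV.
by rewrite clip_id.
Qed.

Lemma bounded_Lip_Dinfty f M V : (forall x, `|f x| <= V) ->
  (forall x, (Lip f x <= M%:E)%E) -> Dinfty X f.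
Proof.
move=> fV fM; split; first exact: bounded_fun_le fV.
apply: le_lt_trans (ltry M); apply: sup_norm_le => x.
by rewrite gee0_abs ?Lip_ge0.
Qed.

(** The representative of [w] obtained from [g] is continuous and equal to [f]
    almost everywhere, hence is [f]. *)
Lemma Lip_le_weak_upper_gradient f w g Z : Dinfty X f -> borel_null mu Z ->
  (forall x, ~ Z x -> w x = (f x)%:E) -> Ntilde mu w ->
  weak_upper_gradient mu w g ->
  (sup_norm (Lip f) <= K%:E * Linfty_norm mu g)%E.
Proof.
move=> Df nZ wf [mw wy _] wg; have K0 := lipschitz_constant_gt0.
have [goo|gy] := eqVneq (Linfty_norm mu g) +oo%E.
  by rewrite goo gt0_muley ?lte_fin// leey.
have gfin : Linfty_norm mu g \is a fin_num.
  by rewrite ge0_fin_numE ?Linfty_norm_ge0// ltey.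
have wfin : Linfty_norm mu w \is a fin_num by rewrite ge0_fin_numE ?Linfty_norm_ge0.
have [|||||f' [N [f'V f'M nN f'N]]] :=
  @Ntilde_representative w g (fine (Linfty_norm mu g)) (fine (Linfty_norm mu w)) mw.
- by rewrite fine_ge0// Linfty_norm_ge0.
- by rewrite fine_ge0// Linfty_norm_ge0.
- by [].
- by rewrite fineK.
- by rewrite fineK.
have Df' := bounded_Lip_Dinfty f'V f'M.
have <- : f' = f.
  apply: (continuous_ae_eq (mu_ball_gt0 dbl) (Dinfty_continuous Df')
    (Dinfty_continuous Df) (borel_nullU nN nZ).2) => x NZx.
  have h1 : w x = (f' x)%:E by apply: f'N => Nx; apply: NZx; left.
  have : w x = (f x)%:E by apply: wf => Zx; apply: NZx; right.
  by rewrite h1 => -[].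
apply: sup_norm_le => x; rewrite gee0_abs ?Lip_ge0//.
by apply: (le_trans (f'M x)); rewrite EFinM fineK.
Qed.

Lemma Dinfty_norm_le f : Dinfty X f ->
  (Dinfty_norm f <= (K + 2)%:E * N1infty_norm mu (N1infty_class mu (EFin \o f)))%E.
Proof.
move=> Df; have K0 := lipschitz_constant_gt0.
have K2 : 0 < K + 2 by rewrite addr_gt0.
rewrite -lee_pdivrMl//; apply/ereal_infP => _ [w wf <-]; rewrite lee_pdivrMl//.
have /(N1infty_classP mu_regular mu_nontrivial)[Nw [Z nZ [fw _]]] := wf.
have {}fw x : ~ Z x -> w x = (f x)%:E.
  by move=> /fw /=; case: (w x) => [t| |]//= /eqP; rewrite -EFinB eqe subr_eq0
    => /eqP ->.
have G0 := weak_upper_gradients_ge0 mu w.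
have N0 := Linfty_norm_ge0 mu w.
have KN : (1%:E <= (K + 2)%:E)%E by rewrite lee_fin; lra.
rewrite /Dinfty_norm ge_max; apply/andP; split.
  apply: (@le_trans _ _ (Linfty_norm mu w)).
    have [_ wy _] := Nw.
    have wfin : Linfty_norm mu w \is a fin_num by rewrite ge0_fin_numE.
    have /(Linfty_normP mu_regular mu_nontrivial)[Z' nZ' wZ'] :
      (Linfty_norm mu w <= (fine (Linfty_norm mu w))%:E)%E by rewrite fineK.
    apply: sup_norm_le => x; rewrite -[leRHS]fineK// lee_fin.
    apply: (continuous_ae_le (mu_ball_gt0 dbl) (Dinfty_continuous Df)
      (borel_nullU nZ nZ').2) => y ZZy.
    have := wZ' y; rewrite fw; last by move=> Zy; apply: ZZy; left.
    by rewrite lee_fin; apply => Zy; apply: ZZy; right.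
  apply: (@le_trans _ _ (Ntilde_norm mu w)); first by rewrite /Ntilde_norm leeDl.
  by rewrite -[leLHS]mul1e lee_wpmul2r// Ntilde_norm_ge0.
apply: (@le_trans _ _ (K%:E * ereal_inf
    [set Linfty_norm mu g | g in weak_upper_gradient mu w])%E).
  rewrite -lee_pdivrMl//; apply/ereal_infP => _ [g wg <-]; rewrite lee_pdivrMl//.
  exact: (Lip_le_weak_upper_gradient Df nZ fw Nw wg).
apply: (@le_trans _ _ ((K + 2)%:E * ereal_inf
    [set Linfty_norm mu g | g in weak_upper_gradient mu w])%E).
  by rewrite lee_wpmul2r// lee_fin lerDl.
by rewrite lee_pmul2l// /Ntilde_norm leeDr.
Qed.

Lemma N1infty_norm_le f : Dinfty X f ->
  (N1infty_norm mu (N1infty_class mu (EFin \o f)) <= (K + 2)%:E * Dinfty_norm f)%E.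
Proof.
move=> Df; apply: (@le_trans _ _ (Ntilde_norm mu (EFin \o f))).
  by apply: ereal_inf_lbound; exists (EFin \o f) => //; exact: mem_N1infty_class.
apply: (le_trans (Ntilde_norm_le mu_regular mu_nontrivial Df)).
rewrite lee_wpmul2r//; first by rewrite le_max sup_norm_ge0.
by rewrite lee_fin lerDr ltW// lipschitz_constant_gt0.
Qed.

Lemma Dinfty_N1infty_bij :
  set_bij (Dinfty X) (N1infty mu) (fun f => N1infty_class mu (EFin \o f)).
Proof.
split.
- by move=> f Df; exists (EFin \o f) => //; exact: Dinfty_Ntilde.
- move=> f h /set_mem Df /set_mem Dh fh.
  have : N1infty_class mu (EFin \o f) (EFin \o h).
    by rewrite fh; exact: mem_N1infty_class.
  move=> /(N1infty_classP mu_regular mu_nontrivial)[_ [Z nZ [fhZ _]]].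
  apply: (continuous_ae_eq (mu_ball_gt0 dbl) (Dinfty_continuous Df)
    (Dinfty_continuous Dh) nZ.2) => x /fhZ /= /sub_EFin_eq0.
  by move=> [].
move=> _ [u Nu <-]; have [mu_ uy [g wg gy]] := Nu.
have [|||||f [N [fV fM nN fN]]] :=
  @Ntilde_representative u g (fine (Linfty_norm mu g)) (fine (Linfty_norm mu u)) mu_.
- by rewrite fine_ge0// Linfty_norm_ge0.
- by rewrite fine_ge0// Linfty_norm_ge0.
- by [].
- by rewrite fineK// ge0_fin_numE// Linfty_norm_ge0.
- by rewrite fineK// ge0_fin_numE// Linfty_norm_ge0.
have Df := bounded_Lip_Dinfty fV fM.
exists f => //.
by rewrite (N1infty_class_eq mu_regular mu_nontrivial nN fN Df Nu).
Qed.

End PoincareRepresentative.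

Theorem corollary5p19 (R : realType) (X : completeMetricType R)
    (mu : {outer_measure set X -> \bar R}) (p : R)
    (mu_regular : borel_regular mu)
    (mu_doubling : doubling mu)
    (mu_nontrivial : (0 < mu setT)%E)
    (mu_finite : forall (x : X) (r : R), (mu (ball x r) < +oo)%E)
    (p_ge1 : 1 <= p)
    (poincare : supports_local_weak_poincare mu p) :
  let cls (f : X -> R) := N1infty_class mu (EFin \o f) in
  set_bij (Dinfty X) (N1infty mu) cls /\
  exists2 C : R, 0 < C & forall f : X -> R, Dinfty X f ->
    (Dinfty_norm f <= C%:E * N1infty_norm mu (cls f))%E /\
    (N1infty_norm mu (cls f) <= C%:E * Dinfty_norm f)%E.
Proof.
have [C C_gt0 C_doubling] := mu_doubling.
have dbl : doubling_with mu C by split.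
have [Cp Cp_gt0 poinc] := poincare.
split; first exact: (Dinfty_N1infty_bij mu_regular mu_nontrivial dbl p_ge1 Cp_gt0 poinc).
exists (lipschitz_constant C Cp + 2) => [|f Df].
  by rewrite addr_gt0// (lipschitz_constant_gt0 dbl).
split.
  exact: (Dinfty_norm_le mu_regular mu_nontrivial dbl p_ge1 Cp_gt0 poinc).
exact: (N1infty_norm_le mu_regular mu_nontrivial dbl Cp_gt0 Df).
Qed.
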